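(* Let $n\ge2$ and let $\Omega$ be a bounded open domain in $\mathbb{H}^n$. Assume that there exists an isometry $\sigma:\mathbb{H}^n\to\mathbb{H}^n$ such that $\sigma(\overline{\Omega})=\overline{\Omega}$. Let $u\in C^0(\overline{\Omega})\cap C^2(\Omega)$ be such that $\Gamma(p)=(p,u(p))$ is a space-like translator and $u\circ\sigma=u$ on $\partial\Omega$. Then $u$ is invariant with respect to $\sigma$ (i.e. $u\circ\sigma=u$); that is to say, $\Gamma$ is invariant by $\sigma\times\mathrm{id}$.
   Context: $\mathbb{H}^n$ is hyperbolic space with its metric $g_{\mathbb{H}^n}$, and the ambient space is $\mathbb{H}^n\times\mathbb{R}$ with the Lorentzian metric $g_{\mathbb{H}^n}-dt^2$. For $u\in C^2(\Omega)$, the graph $\Gamma_u(p)=(p,u(p))$ is space-like if $|\nabla u|<1$ on $\Omega$ (gradient, norm and divergence with respect to $g_{\mathbb{H}^n}$). A space-like graph is a translator if its mean curvature vector (trace of the second fundamental form) equals $\partial_t^\perp$, the normal projection of $\partial_t$; equivalently, on $\Omega$, $$\mathrm{div}\left(\frac{\nabla u}{\sqrt{1-|\nabla u|^2}}\right)=\frac{1}{\sqrt{1-|\nabla u|^2}}.$$ *)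

(* Defs.v *)
From HB Require Import structures.
From mathcomp Require Import all_boot all_order all_algebra.
From mathcomp Require Import all_classical all_reals all_analysis.

Set Implicit Arguments.
Unset Strict Implicit.
Unset Printing Implicit Defensive.
Import Order.TTheory GRing.Theory Num.Theory.
Import numFieldNormedType.Exports.
Local Open Scope classical_set_scope.
Local Open Scope ring_scope.

Section Calculus.
Variables (R : realType) (n : nat) (V : normedModType R).

Definition partial (i : 'I_n) (f : 'rV[R]_n -> V) : 'rV[R]_n -> V :=
  'D_(delta_mx 0 i) f.

(* [U] is meant to be open. *)
Fixpoint Ck (k : nat) (U : set 'rV[R]_n) (f : 'rV[R]_n -> V) : Prop :=
  (forall x, U x -> {for x, continuous f}) /\
  (if k is k'.+1 then
     forall i : 'I_n, (forall x, U x -> derivable f x (delta_mx 0 i)) /\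
                      Ck k' U (partial i f)
   else True).

Definition smooth (U : set 'rV[R]_n) (f : 'rV[R]_n -> V) : Prop :=
  forall k, Ck k U f.

Definition C1_curve (c : R -> V) : Prop :=
  (forall t, derivable c t 1) /\ continuous (derive1 c).

End Calculus.

(* Pseudo-Riemannian geometry of a coordinate domain of R^m; [G x] is the
   matrix of the metric at [x] in the coordinate frame. *)
Section Metric.
Variables (R : realType) (m : nat) (G : 'rV[R]_m -> 'M[R]_m).

Definition inner (x v w : 'rV[R]_m) : R := (v *m G x *m w^T) 0 0.

Definition tnorm (x v : 'rV[R]_m) : R := Num.sqrt (inner x v v).

(* (grad f)^k = sum_i (d_i f) g^{ik} *)
Definition grad (f : 'rV[R]_m -> R) (x : 'rV[R]_m) : 'rV[R]_m :=
  (\row_i partial i f x) *m invmx (G x).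

(* The vector whose k-th component is the Christoffel symbol Gamma^k_{ij}
   = 1/2 sum_l (d_i g_{jl} + d_j g_{il} - d_l g_{ij}) g^{lk},
   that is, the Levi-Civita derivative of the j-th coordinate field along the
   i-th one. *)
Definition christoffel (i j : 'I_m) (x : 'rV[R]_m) : 'rV[R]_m :=
  (\row_l (2^-1 * (partial i (fun y => G y j l) x
                   + partial j (fun y => G y i l) x
                   - partial l (fun y => G y i j) x))) *m invmx (G x).

Definition curve_length (c : R -> 'rV[R]_m) : R :=
  (\int[lebesgue_measure]_(t in `[0%R, 1%R]) tnorm (c t) (derive1 c t))%R.

(* Riemannian distance on the coordinate domain [U].  Only the restriction of
   a curve to [0, 1] matters: every C^1 curve on [0, 1] extends to R. *)
Definition riem_dist (U : set 'rV[R]_m) (p q : 'rV[R]_m) : R :=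
  inf [set L | exists c : R -> 'rV[R]_m,
    [/\ C1_curve c, c 0 = p, c 1 = q,
        (forall t, 0 <= t <= 1 -> U (c t)) & L = curve_length c]].

Definition riem_bounded (U A : set 'rV[R]_m) : Prop :=
  exists p r, U p /\ forall q, A q -> riem_dist U p q <= r.

(* Riemannian isometries of [U] onto itself; the values of [s] outside [U] are
   irrelevant, and ['D_v s x] is the differential of [s] at [x] applied
   to [v]. *)
Definition riem_isometry (U : set 'rV[R]_m) (s : 'rV[R]_m -> 'rV[R]_m) : Prop :=
  [/\ smooth U s, (forall x, U x -> U (s x)),
      (exists s' : 'rV[R]_m -> 'rV[R]_m,
        [/\ smooth U s', (forall x, U x -> U (s' x)),
            (forall x, U x -> s' (s x) = x) & (forall x, U x -> s (s' x) = x)])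
    & forall x v w, U x -> inner (s x) ('D_v s x) ('D_w s x) = inner x v w].

End Metric.

(* Extrinsic geometry of an immersion [F] of a domain of R^n into a coordinate
   domain of R^m with metric [G], in the coordinate frame of R^n. *)
Section Immersion.
Variables (R : realType) (n m : nat) (G : 'rV[R]_m -> 'M[R]_m).
Variable (F : 'rV[R]_n -> 'rV[R]_m).

Definition first_form (x : 'rV[R]_n) : 'M[R]_n :=
  \matrix_(i, j) inner G (F x) (partial i F x) (partial j F x).

Definition tangent_proj (x : 'rV[R]_n) (w : 'rV[R]_m) : 'rV[R]_m :=
  \sum_i \sum_j (invmx (first_form x) i j * inner G (F x) w (partial j F x))
                *: partial i F x.

Definition normal_proj (x : 'rV[R]_n) (w : 'rV[R]_m) : 'rV[R]_m :=
  w - tangent_proj x w.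

(* Ambient Levi-Civita derivative of the j-th tangent field along the i-th
   one. *)
Definition ambient_deriv (i j : 'I_n) (x : 'rV[R]_n) : 'rV[R]_m :=
  partial i (partial j F) x
  + \sum_a \sum_b (partial i F x 0 a * partial j F x 0 b)
                  *: christoffel G a b (F x).

Definition second_form (i j : 'I_n) (x : 'rV[R]_n) : 'rV[R]_m :=
  normal_proj x (ambient_deriv i j x).

Definition mean_curvature (x : 'rV[R]_n) : 'rV[R]_m :=
  \sum_i \sum_j invmx (first_form x) i j *: second_form i j x.

End Immersion.

(* Hyperbolic space in the Poincare ball model: the unit ball of R^n with the
   metric 4 |dx|^2 / (1 - |x|^2)^2.  Its topology is induced by that of R^n. *)
Section Hyperbolic.
Variables (R : realType) (n : nat).

Definition sqnorm (x : 'rV[R]_n) : R := \sum_i x 0 i ^+ 2.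

Definition hyp : set 'rV[R]_n := [set x | sqnorm x < 1].

Definition ghyp (x : 'rV[R]_n) : 'M[R]_n := ((2 / (1 - sqnorm x)) ^+ 2)%:M.

Definition hclosure (A : set 'rV[R]_n) : set 'rV[R]_n := closure A `&` hyp.

Definition hboundary (A : set 'rV[R]_n) : set 'rV[R]_n :=
  hclosure A `\` interior A.

(* H^n x R with the Lorentzian metric g - dt^2; t is the last coordinate. *)
Definition glorentz (z : 'rV[R]_(n + 1)) : 'M[R]_(n + 1) :=
  block_mx (ghyp (lsubmx z)) 0 0 (-1)%:M.

Definition dt : 'rV[R]_(n + 1) := row_mx 0 1%:M.

Definition graph_of (u : 'rV[R]_n -> R) (x : 'rV[R]_n) : 'rV[R]_(n + 1) :=
  row_mx x (u x)%:M.

Definition spacelike (O : set 'rV[R]_n) (u : 'rV[R]_n -> R) : Prop :=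
  forall x, O x -> tnorm ghyp x (grad ghyp u x) < 1.

Definition translator (O : set 'rV[R]_n) (u : 'rV[R]_n -> R) : Prop :=
  forall x, O x ->
    mean_curvature glorentz (graph_of u) x
    = normal_proj glorentz (graph_of u) x dt.

Definition times_id (s : 'rV[R]_n -> 'rV[R]_n) (z : 'rV[R]_(n + 1)) :
    'rV[R]_(n + 1) :=
  row_mx (s (lsubmx z)) (rsubmx z).

End Hyperbolic.

Arguments hyp {R n}.
Arguments ghyp {R n}.

(* Main.v *)
Require Import Defs.
From HB Require Import structures.
From mathcomp Require Import all_boot all_order all_algebra.
From mathcomp Require Import all_classical all_reals all_analysis.
From mathcomp Require Import ring lra zify.

(** On H^n the translator equation of a graph reads, in the coordinates of the
    ball model, as a quasilinear elliptic equation that is invariant under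
    isometries and under adding constants to [u].

    The classical comparison argument does not apply directly because [sigma] may
    move a boundary point of [Omega] into [Omega] (think of a ball minus a closed
    set).  Instead, consider all pairs (p, q) with q in the closure of the
    forward orbit of p under [sigma].  As isometries are uniformly bi-Lipschitz on
    the compact closure of [Omega], this is a compact equivalence relation, and
    u q - u p has a maximum M on it.  If M > 0, choose a maximal pair with u p
    largest possible.  Since u o sigma = u on the boundary, p and q may be moved
    along their orbits, without changing u, until they lie in [Omega].

    Near p compare u o sigma^k, for a suitable k, with u - eps h, where
    h = t + t^2 / 2 - |x - p|^2 and t = al (u - u p).  The choice of p makes
    u o sigma^k - u + eps h have an interior local maximum near p for small eps.
    For al large, u - eps h is a strict supersolution near p: when grad u p = 0
    because the translator equation forces the second order part of u to be
    positive, and otherwise because of the term t^2 / 2.  This excludes such a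
    maximum, so M = 0. *)

Set Implicit Arguments.
Unset Strict Implicit.
Unset Printing Implicit Defensive.
Import Order.TTheory GRing.Theory Num.Theory.
Import numFieldNormedType.Exports.
Local Open Scope classical_set_scope.
Local Open Scope ring_scope.

(** * Calculus in several variables *)

(** No strong maximum principle is invoked; strictness comes from the second extremal choice. A
    maximal pair whose first point x lies on a small sphere around p has u x <= u p, so there t is
    in [-2, 0], t + t^2 / 2 <= 0 and h <= - |x - p|^2. By compactness the pairs on the sphere where
    h is not clearly negative stay below M by a fixed amount, which absorbs eps h for small eps. At
    p itself h vanishes.

    The point q is only a limit of iterates of p. Instead of extracting a limit isometry from p to
    q, the proof uses one iterate with sigma^k p close to q. The gap on the sphere is uniform over
    all pairs of the relation, so eps is fixed before k, and k is then taken so large an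
    approximation that u q - u (sigma^k p) is smaller than the gap.

    Symmetry of the relation makes M positive whatever the sign of u o sigma - u; it rests on the
    recurrence of orbits of an isometry in a compact set. *)

Lemma growth_line (R : realType) (n : nat) (f : 'rV[R]_n -> R)
    (y v : 'rV[R]_n) (t : R) :
  (fun h : R => h^-1 *: (((fun s : R => f (y + s *: v)) \o shift t) (h *: (1 : R))
     - f (y + t *: v))) =
  (fun h : R => h^-1 *: ((f \o shift (y + t *: v)) (h *: v) - f (y + t *: v))).
Proof.
apply/funext => h /=; congr (_ *: (f _ - _)).
by rewrite /shift /= scalerDl addrCA -scalerA scale1r.
Qed.

Lemma is_derive_line (R : realType) (n : nat) (f : 'rV[R]_n -> R)
    (y v : 'rV[R]_n) (t : R) :
  derivable f (y + t *: v) v ->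
  is_derive t (1 : R) (fun s : R => f (y + s *: v)) ('D_v f (y + t *: v)).
Proof.
move=> df; have gl := growth_line f y v t.
by split; rewrite /derivable /derive gl.
Qed.

(** Only derivability along [v] is assumed, so this applies to partial derivatives before
    differentiability is known. *)
Lemma mvt_dir (R : realType) (n : nat) (f : 'rV[R]_n -> R) (y v : 'rV[R]_n) :
  (forall t : R, 0 <= t <= 1 -> derivable f (y + t *: v) v) ->
  exists2 t : R, 0 < t < 1 & f (y + v) - f y = 'D_v f (y + t *: v).
Proof.
move=> df.
have dl (t : R) : 0 <= t <= 1 -> is_derive t (1 : R) (fun s : R => f (y + s *: v))
   ('D_v f (y + t *: v)) by move=> /df; exact: is_derive_line.
have cl : {within `[0%R, 1%R], continuous (fun s : R => f (y + s *: v))}.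
  apply: derivable_within_continuous => t t01; apply/ex_derive/dl.
  by move: t01; rewrite in_itv.
have [t] := MVT ltr01 (fun t t01 => dl t (subset_itv_oo_cc t01)) cl.
rewrite scale0r addr0 scale1r subr0 mulr1 => t01 ->.
by exists t => //; move: t01; rewrite in_itv.
Qed.

Lemma derivable_scale_dir (R : realType) (n : nat) (f : 'rV[R]_n -> R)
    (y v : 'rV[R]_n) (c : R) :
  derivable f y v -> derivable f y (c *: v) /\ 'D_(c *: v) f y = c * 'D_v f y.
Proof.
move=> df.
have H : is_derive (c * 0) (1 : R) (fun s : R => f (y + s *: v)) ('D_v f y).
  have := @is_derive_line R n f y v 0.
  by rewrite mulr0 scale0r addr0; apply.
have cl : is_derive (0 : R) (1 : R) (fun s : R => c * s) c.
  by apply: is_derive_eq; rewrite ?scaler0 ?addr0 ?add0r /GRing.scale /= ?mulr1.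
have [H1 H2] := @is_derive1_comp R _ (fun s => c * s) 0 _ _ H cl.
have E : (fun s : R => f (y + s *: v)) \o (fun s => c * s) =
   (fun s => f (y + s *: (c *: v))).
  by apply/funext => s /=; rewrite scalerA mulrC.
move: H1 H2; rewrite E /derivable /derive.
have := growth_line f y (c *: v) 0; rewrite scale0r addr0 => -> H1 H2.
by split => //; rewrite H2 mulrC.
Qed.

Definition dot (R : realType) (n : nat) (v w : 'rV[R]_n) : R :=
  \sum_i v 0 i * w 0 i.

Definition egrad (R : realType) (n : nat) (f : 'rV[R]_n -> R) (x : 'rV[R]_n) :
  'rV[R]_n := \row_i partial i f x.

Definition ehess (R : realType) (n : nat) (f : 'rV[R]_n -> R) (x : 'rV[R]_n) :
  'M[R]_n := \matrix_(i, j) partial i (partial j f) x.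

Section Dot.
Variables (R : realType) (n : nat).
Implicit Types (v w p : 'rV[R]_n) (c : R).

Lemma dotC v w : dot v w = dot w v.
Proof. by apply: eq_bigr => i _; rewrite mulrC. Qed.

Lemma dotDl v w p : dot (v + w) p = dot v p + dot w p.
Proof. by rewrite -big_split; apply: eq_bigr => i _; rewrite mxE mulrDl. Qed.

Lemma dotZl c v p : dot (c *: v) p = c * dot v p.
Proof. by rewrite mulr_sumr; apply: eq_bigr => i _; rewrite mxE mulrA. Qed.

Lemma dotNl v p : dot (- v) p = - dot v p.
Proof. by rewrite -scaleN1r dotZl mulN1r. Qed.

Lemma dotBl v w p : dot (v - w) p = dot v p - dot w p.
Proof. by rewrite dotDl dotNl. Qed.

Lemma dotDr v w p : dot p (v + w) = dot p v + dot p w.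
Proof. by rewrite dotC dotDl !(dotC _ p). Qed.

Lemma dotZr c v p : dot p (c *: v) = c * dot p v.
Proof. by rewrite dotC dotZl dotC. Qed.

Lemma dotNr v p : dot p (- v) = - dot p v.
Proof. by rewrite dotC dotNl dotC. Qed.

Lemma dotBr v w p : dot p (v - w) = dot p v - dot p w.
Proof. by rewrite dotDr dotNr. Qed.

Lemma dot0l p : dot 0 p = 0.
Proof. by rewrite -(scale0r 0) dotZl mul0r. Qed.

Lemma dot0r p : dot p 0 = 0.
Proof. by rewrite dotC dot0l. Qed.

Lemma dot_mulmx m (v : 'rV[R]_m) (A : 'M[R]_(m, n)) w :
  dot (v *m A) w = dot v (w *m A^T).
Proof.
rewrite /dot; under eq_bigr do rewrite mxE mulr_suml.
rewrite exchange_big; apply: eq_bigr => i _; rewrite mxE mulr_sumr.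
by apply: eq_bigr => j _; rewrite mxE -mulrA (mulrC (A i j)).
Qed.

Lemma dotE v w : (v *m w^T) 0 0 = dot v w.
Proof. by rewrite mxE; apply: eq_bigr => i _; rewrite mxE. Qed.

Lemma dot_delta v i : dot v (delta_mx 0 i) = v 0 i.
Proof.
rewrite /dot (bigD1 i) //= big1 ?mxE ?eqxx ?mulr1 ?addr0 // => j ji.
by rewrite mxE (negbTE ji) mulr0.
Qed.

Lemma dot_deltal v i : dot (delta_mx 0 i) v = v 0 i.
Proof. by rewrite dotC dot_delta. Qed.

Lemma dotvv v : dot v v = sqnorm v.
Proof. by apply: eq_bigr => i _; rewrite expr2. Qed.

Lemma sqnorm_ge0 v : 0 <= sqnorm v.
Proof. by apply: sumr_ge0 => i _; exact: sqr_ge0. Qed.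

Lemma sqnorm_eq0 v : (sqnorm v == 0) = (v == 0).
Proof.
apply/eqP/eqP => [v0|->]; last by rewrite -dotvv dot0l.
apply/rowP => i; rewrite mxE.
have : v 0 i ^+ 2 = 0.
  apply/eqP; rewrite eq_le sqr_ge0 andbT -v0 /sqnorm (bigD1 i) //= lerDl.
  by apply: sumr_ge0 => j _; exact: sqr_ge0.
by move/eqP; rewrite sqrf_eq0 => /eqP.
Qed.

Lemma coord_le_sqnorm v i : v 0 i ^+ 2 <= sqnorm v.
Proof.
rewrite /sqnorm (bigD1 i) //= lerDl.
by apply: sumr_ge0 => j _; exact: sqr_ge0.
Qed.

Lemma coord_le_norm v i : `|v 0 i| <= `|v|.
Proof.
rewrite [leRHS]/Num.Def.normr /= mx_normrE.
exact: (le_bigmax _ (fun ij : 'I_1 * 'I_n => `|v ij.1 ij.2|) (0, i)).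
Qed.

Lemma norm_le_coord v c : 0 <= c -> (forall i, `|v 0 i| <= c) -> `|v| <= c.
Proof.
move=> c0 h; rewrite [leLHS]/Num.Def.normr /= mx_normrE.
by apply: bigmax_le => // -[i j] _ /=; rewrite ord1.
Qed.

Lemma sqnorm_le_norm v : sqnorm v <= n%:R * `|v| ^+ 2.
Proof.
apply: (@le_trans _ _ (\sum_(i < n) `|v| ^+ 2)); last first.
  by rewrite sumr_const card_ord mulr_natl.
apply: ler_sum => i _; rewrite -real_normK ?num_real //.
by rewrite ler_sqr ?nnegrE // coord_le_norm.
Qed.

Lemma norm_sqr_le_sqnorm v : `|v| ^+ 2 <= sqnorm v.
Proof.
rewrite -[leRHS]sqr_sqrtr ?sqnorm_ge0 // ler_sqr ?nnegrE ?sqrtr_ge0 //.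
apply: norm_le_coord => [|i]; rewrite ?sqrtr_ge0 // -sqrtr_sqr.
by rewrite ler_wsqrtr // coord_le_sqnorm.
Qed.

Lemma cauchy_schwarz v w : dot v w ^+ 2 <= sqnorm v * sqnorm w.
Proof.
have [->|w0] := eqVneq w 0.
  by rewrite dot0r expr0n /= mulr_ge0 ?sqnorm_ge0.
have sw : 0 < sqnorm w by rewrite lt_neqAle sqnorm_ge0 eq_sym sqnorm_eq0 w0.
have E : sqnorm (sqnorm w *: v - dot v w *: w) =
    sqnorm w * (sqnorm v * sqnorm w - dot v w ^+ 2).
  rewrite -dotvv !(dotBl, dotBr, dotZl, dotZr) (dotC w v) !dotvv; ring.
by have := sqnorm_ge0 (sqnorm w *: v - dot v w *: w);
  rewrite E pmulr_rge0 // subr_ge0.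
Qed.

Lemma is_diff_coord (x : 'rV[R]_n) i :
  is_diff x (fun y : 'rV[R]_n => y 0 i : R) (fun v : 'rV[R]_n => v 0 i : R).
Proof.
have @f : {linear 'rV[R]_n -> R}.
  by exists (fun N : 'rV[R]_n => N 0 i); do 2![eexists]; do ?[constructor];
     rewrite ?mxE// => ? *; rewrite ?mxE//; move=> ?; rewrite !mxE.
apply: DiffDef; first exact: differentiable_coord.
rewrite (_ : (fun _ => _) = f) // diff_lin //; exact: coord_continuous.
Qed.

Lemma is_diff_component m (x : 'rV[R]_m) (g dg : 'rV[R]_m -> 'rV[R]_n) i :
  is_diff x g dg -> is_diff x (fun y : 'rV[R]_m => g y 0 i : R) (fun v : 'rV[R]_m => dg v 0 i : R).
Proof. by move=> dgx; exact: (is_diff_comp dgx (is_diff_coord (g x) i)). Qed.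

Lemma is_diff_row m (x : 'rV[R]_m) (g dg : 'rV[R]_m -> 'rV[R]_n) :
  (forall i, is_diff x (fun y : 'rV[R]_m => g y 0 i : R) (fun v : 'rV[R]_m => dg v 0 i : R)) ->
  is_diff x g dg.
Proof.
move=> h.
have dfg : differentiable g x.
  have -> : g = \sum_(i < n) (fun y => g y 0 i *: (delta_mx 0 i : 'rV[R]_n)).
    apply/funext => y; rewrite fct_sumE; exact: row_sum_delta.
  apply: differentiable_sum => i; apply: differentiableZl.
  exact: (@ex_diff _ _ _ _ _ _ _ (h i)).
apply: DiffDef => //; apply/funext => v; apply/rowP => i.
have := diff_val (is_diff_def := h i).
by rewrite (diff_val (is_diff_def := is_diff_component i (differentiableP dfg))) => /(congr1 (@^~ v)).
Qed.

End Dot.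

Lemma norm_delta_le1 (R : realType) n (i : 'I_n) : `|delta_mx 0 i : 'rV[R]_n| <= 1.
Proof.
apply: norm_le_coord => // j; rewrite mxE /=.
by case: (j == i); rewrite ?normr1 ?normr0 ?ler01.
Qed.

Lemma near_distP (R : realType) n (x : 'rV[R]_n) (P : set 'rV[R]_n) :
  (\forall y \near x, P y) <->
  exists2 d : R, 0 < d & forall y, `|y - x| < d -> P y.
Proof.
split.
  move=> /nbhs_ballP[d d0 h]; exists d => // y yd; apply: h.
  by rewrite mx_norm_ball /ball_ /= distrC.
move=> [d d0 h]; apply/nbhs_ballP; exists d => // y.
by rewrite mx_norm_ball /ball_ /= distrC; exact: h.
Qed.

(** * Differentiability from continuous partial derivatives *)

(** The coordinates in [s] are moved one at a time: each move is a mean value estimate along one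
    axis, where the partial derivative differs from its value at [x] by at most [e]. *)
Lemma strong_diff (R : realType) (n : nat) (f : 'rV[R]_n -> R) (x : 'rV[R]_n)
    (s : seq 'I_n) :
  (forall i, \forall y \near x, derivable f y (delta_mx 0 i)) ->
  (forall i, {for x, continuous (partial i f)}) ->
  forall e : R, 0 < e -> exists2 d : R, 0 < d &
    forall y (c : 'I_n -> R), `|y - x| < d -> (forall i, `|c i| < d) ->
    `|f (y + \sum_(i <- s) c i *: delta_mx 0 i) - f y
       - \sum_(i <- s) c i * partial i f x| <= e * \sum_(i <- s) `|c i|.
Proof.
move=> df cf e e0; elim: s => [|i s [d d0 IH]].
  by exists 1 => // y c _ _; rewrite !big_nil addr0 subrr subr0 mulr0 normr0.
have [d1 d10 h1] := (near_distP _ _).1 (df i).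
have /cvgrPdist_le/(_ e e0)/near_distP[d2 d20 h2] := cf i.
(* [N] counts the pieces of the broken path from [x]: the offset [y - x], one move for each
   coordinate of the tail, and the head move. Each has norm at most [m / N]. *)
pose N : R := (size s).+2%:R.
have N0 : 0 < N by [].
pose m := Num.min d (Num.min d1 d2).
have m0 : 0 < m by rewrite !lt_min d0 d10.
exists (m / N); first by rewrite divr_gt0.
have mN : m / N <= m by rewrite ler_pdivrMr // ler_peMr ?ler1n // ltW.
move=> y c yx cm; rewrite !big_cons.
set z := \sum_(j <- s) _.
have zle : `|z| <= m / N * (size s)%:R.
  rewrite /z; elim: (s) => [|j r IHr]; first by rewrite big_nil normr0 mulr0.
  rewrite big_cons /= -[(size r).+1%:R]natr1 mulrDr mulr1 [leRHS]addrC.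
  apply: le_trans (ler_normD _ _) _; apply: lerD IHr.
  rewrite normrZ -[leRHS]mulr1; apply: ler_pM; rewrite ?norm_delta_le1 //.
  exact/ltW.
have zx (t : R) : 0 <= t <= 1 ->
    `|y + z + t *: (c i *: delta_mx 0 i) - x| < m.
  move=> /andP[t0 t1].
  have -> : y + z + t *: (c i *: delta_mx 0 i) - x =
      (y - x) + z + t *: (c i *: delta_mx 0 i) by rewrite addrAC (addrAC y).
  have -> : m = m / N + m / N * (size s)%:R + m / N.
    have NE : N = 1 + (size s)%:R + 1 by rewrite nat1r natr1.
    have {1}-> : m = m / N * N by rewrite divfK // lt0r_neq0.
    by rewrite {2}NE !mulrDr !mulr1.
  apply: le_lt_trans (ler_normD _ _) _; apply: ltr_leD.
    apply: le_lt_trans (ler_normD _ _) _; exact: ltr_leD.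
  rewrite scalerA normrZ -[leRHS]mulr1; apply: ler_pM; rewrite ?norm_delta_le1 //.
  rewrite normrM (ger0_norm t0) -[leRHS]mul1r; apply: ler_pM => //.
  exact/ltW.
have dfz (t : R) : 0 <= t <= 1 ->
    derivable f (y + z + t *: (c i *: delta_mx 0 i)) (delta_mx 0 i).
  by move=> /zx zt; apply: h1; apply: lt_le_trans zt _; rewrite /m !ge_min lexx orbT.
have [t t01 ft] := mvt_dir (fun t t01 => (derivable_scale_dir (c i) (dfz t t01)).1).
have t01' : 0 <= t <= 1 by case/andP: t01 => /ltW-> /ltW->.
move: ft; rewrite (derivable_scale_dir (c i) (dfz t t01')).2 => ft.
have -> : y + (c i *: delta_mx 0 i + z) = y + z + c i *: delta_mx 0 i.
  by rewrite addrA addrAC.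
set q := y + z + t *: _ in ft.
have hq : `|partial i f q - partial i f x| <= e.
  rewrite distrC; apply: h2; apply: lt_le_trans (zx t t01') _.
  by rewrite /m !ge_min lexx !orbT.
have -> : f (y + z + c i *: delta_mx 0 i) - f y -
   (c i * partial i f x + \sum_(j <- s) c j * partial j f x) =
   c i * (partial i f q - partial i f x) +
   (f (y + z) - f y - \sum_(j <- s) c j * partial j f x).
  rewrite mulrBr -[c i * partial i f q]ft; ring.
apply: le_trans (ler_normD _ _) _; rewrite [leRHS]mulrDr; apply: lerD.
  by rewrite normrM mulrC ler_wpM2r.
apply: IH => [|j].
  by apply: lt_le_trans yx _; apply: le_trans mN _; rewrite /m ge_min lexx.
by apply: lt_le_trans (cm j) _; apply: le_trans mN _; rewrite /m ge_min lexx.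
Qed.

Lemma is_diff_linear (R : realType) (n : nat) (f : 'rV[R]_n -> R)
    (L : {linear 'rV[R]_n -> R}) (x : 'rV[R]_n) : continuous L ->
  (forall e : R, 0 < e ->
     \forall v \near (0 : 'rV[R]_n), `|f (v + x) - (f x + L v)| <= e * `|v|) ->
  is_diff x f L.
Proof.
move=> Lc h.
have dv : 'd f x = L :> (_ -> _).
  by apply: diff_unique => //; apply/eqaddoP => e e0; exact: h.
apply: DiffDef => //; apply/diff_locallyP; rewrite dv; split => //.
by apply/eqaddoP => e e0; exact: h.
Qed.

Lemma is_diff_dot (R : realType) (n : nat) (p x : 'rV[R]_n) :
  is_diff x (fun v : 'rV[R]_n => dot v p) (fun v : 'rV[R]_n => dot v p).
Proof.
have dl : linear (fun v : 'rV[R]_n => dot v p : R).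
  by move=> a v w; rewrite dotDl dotZl.
pose lM := GRing.isLinear.Build _ _ _ _ _ dl.
pose L : {linear 'rV[R]_n -> R} := HB.pack (fun v : 'rV[R]_n => dot v p : R) lM.
have dfd y : differentiable (fun v : 'rV[R]_n => dot v p : R) y.
  have -> : (fun v : 'rV[R]_n => dot v p : R) =
      \sum_(i < n) (fun v : 'rV[R]_n => v 0 i *: p 0 i).
    by apply/funext => v; rewrite fct_sumE.
  apply: differentiable_sum => i; apply: differentiableZl.
  exact: differentiable_coord.
apply: DiffDef => //.
have Lc : continuous L by move=> y; exact/differentiable_continuous/dfd.
exact: (diff_lin x Lc).
Qed.

Lemma C1_is_diff (R : realType) (n : nat) (U : set 'rV[R]_n)
    (f : 'rV[R]_n -> R) (x : 'rV[R]_n) :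
  open U -> U x -> Ck 1 U f -> is_diff x f (fun v : 'rV[R]_n => dot v (egrad f x)).
Proof.
move=> oU Ux [_ h1].
have nU : \forall y \near x, U y by exact: open_nbhs_nbhs.
have df i : \forall y \near x, derivable f y (delta_mx 0 i).
  by apply: filterS nU => y; exact: (h1 i).1.
have cf i : {for x, continuous (partial i f)} by exact: ((h1 i).2.1 x Ux).
have SD := strong_diff (index_enum 'I_n) df cf.
have dl : linear (fun v : 'rV[R]_n => dot v (egrad f x) : R).
  by move=> a v w; rewrite dotDl dotZl.
pose lM := GRing.isLinear.Build _ _ _ _ _ dl.
pose L : {linear 'rV[R]_n -> R} :=
  HB.pack (fun v : 'rV[R]_n => dot v (egrad f x) : R) lM.
have Lc : continuous L.
  move=> y; apply: differentiable_continuous.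
  by have [] := is_diff_dot (egrad f x) y.
apply: (@is_diff_linear _ _ _ L) => // e e0.
have e1 : 0 < e / n.+1%:R by rewrite divr_gt0.
have [d d0 hd] := SD _ e1.
apply/near_distP; exists d => // v; rewrite subr0 => vd.
have := hd x (fun i => v 0 i).
rewrite subrr normr0 -row_sum_delta => /(_ d0 (fun i => le_lt_trans (coord_le_norm v i) vd)).
have -> : \sum_i v 0 i * partial i f x = L v.
  by apply: eq_bigr => i _; rewrite mxE.
rewrite (addrC v) opprD addrA => /le_trans; apply.
rewrite -mulrA ler_pM2l // ler_pdivrMl //.
apply: (@le_trans _ _ (\sum_(i < n) `|v|)).
  by apply: ler_sum => i _; exact: coord_le_norm.
by rewrite sumr_const card_ord -[_ *+ n]mulr_natl ler_wpM2r // ler_nat.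
Qed.

(** * Symmetry of second derivatives *)

(** The mean value theorem is used twice: along the [i] axis for the increment of [f] in direction
    [j], then along the [j] axis for [partial i f]. The bound [2 * s < d] keeps the whole square in
    the ball. *)
Lemma schwarz_mean (R : realType) (n : nat) (f : 'rV[R]_n -> R) (x : 'rV[R]_n)
    (i j : 'I_n) (d s : R) : 0 < s -> 2 * s < d ->
  (forall y, `|y - x| < d -> derivable f y (delta_mx 0 i)) ->
  (forall y, `|y - x| < d -> derivable (partial i f) y (delta_mx 0 j)) ->
  exists2 y, `|y - x| < d &
    f (x + s *: delta_mx 0 i + s *: delta_mx 0 j) - f (x + s *: delta_mx 0 i)
    - (f (x + s *: delta_mx 0 j) - f x) = s ^+ 2 * partial j (partial i f) y.
Proof.
move=> s0 sd df ddf.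
pose ei : 'rV[R]_n := delta_mx 0 i; pose ej : 'rV[R]_n := delta_mx 0 j.
have close (a b : R) : 0 <= a <= 1 -> 0 <= b <= 1 ->
    `|x + a *: (s *: ei) + b *: (s *: ej) - x| < d.
  move=> /andP[a0 a1] /andP[b0 b1].
  rewrite -(addrA x) [x + _]addrC addrK; apply: le_lt_trans sd.
  apply: le_trans (ler_normD _ _) _.
  have aux (c : R) (k : 'I_n) : 0 <= c -> c <= 1 ->
      `|c *: (s *: (delta_mx 0 k : 'rV[R]_n))| <= s.
    move=> c0 c1; rewrite !normrZ (ger0_norm c0) (gtr0_norm s0).
    rewrite mulrCA -[leRHS]mulr1 ler_pM2l // -[leRHS]mulr1.
    by apply: ler_pM => //; exact: norm_delta_le1.
  by rewrite mulr_natl mulr2n; apply: lerD; exact: aux.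
pose g := fun y => f (y + s *: ej) - f y.
have sh (y : 'rV[R]_n) : derivable f (y + s *: ej) ei ->
    is_derive y ei (fun z => f (z + s *: ej)) (partial i f (y + s *: ej)).
  move=> h; have E : (fun h : R => h^-1 *:
      (((fun z => f (z + s *: ej)) \o shift y) (h *: ei) - f (y + s *: ej))) =
   (fun h : R => h^-1 *: ((f \o shift (y + s *: ej)) (h *: ei) - f (y + s *: ej))).
    by apply/funext => t /=; rewrite /shift /= addrA.
  by split; rewrite /partial /derivable /derive E.
have one : 0 <= (1 : R) <= 1 by rewrite ler01 lexx.
have zero : 0 <= (0 : R) <= 1 by rewrite ler01 lexx.
have dg (t : R) : 0 <= t <= 1 -> is_derive (x + t *: (s *: ei)) ei g
  (partial i f (x + t *: (s *: ei) + s *: ej) - partial i f (x + t *: (s *: ei))).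
  move=> t01; have h1 := close t 1 t01 one; have h0 := close t 0 t01 zero.
  rewrite scale1r in h1; rewrite scale0r addr0 in h0.
  apply: is_deriveB; first exact/sh/df.
  by apply: derivableP; exact: df.
have [t t01 gt] := mvt_dir (fun t t01 =>
  (derivable_scale_dir s (@ex_derive _ _ _ _ _ _ _ (dg t t01))).1).
have t01' : 0 <= t <= 1 by case/andP: t01 => /ltW-> /ltW->.
move: gt; rewrite (derivable_scale_dir s (@ex_derive _ _ _ _ _ _ _ (dg t t01'))).2.
rewrite (@derive_val _ _ _ _ _ _ _ (dg t t01')) /g => ->.
have dd (b : R) : 0 <= b <= 1 ->
  derivable (partial i f) (x + t *: (s *: ei) + b *: (s *: ej)) ej.
  by move=> b01; apply: ddf; exact: close.
have [b b01 ->] := mvt_dir (fun b b01 => (derivable_scale_dir s (dd b b01)).1).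
have b01' : 0 <= b <= 1 by case/andP: b01 => /ltW-> /ltW->.
rewrite (derivable_scale_dir s (dd b b01')).2 mulrA -expr2.
by exists (x + t *: (s *: ei) + b *: (s *: ej)) => //; exact: close.
Qed.

Lemma schwarz (R : realType) (n : nat) (U : set 'rV[R]_n)
    (f : 'rV[R]_n -> R) (x : 'rV[R]_n) (i j : 'I_n) :
  open U -> U x -> Ck 2 U f ->
  partial i (partial j f) x = partial j (partial i f) x.
Proof.
move=> oU Ux [_ h2].
have df k y : U y -> derivable f y (delta_mx 0 k) by exact: (h2 k).1.
have ddf k l y : U y -> derivable (partial k f) y (delta_mx 0 l).
  exact: ((h2 k).2.2 l).1.
have cf k l : {for x, continuous (partial l (partial k f))}.
  exact: ((h2 k).2.2 l).2.1.
have [d d0 hd] : exists2 d : R, 0 < d & forall y, `|y - x| < d -> U y.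
  by apply/near_distP; exact: open_nbhs_nbhs.
apply/eqP; rewrite -subr_eq0 -normr_le0; apply/ler_addgt0Pl => e e0.
rewrite addr0.
have e2 : 0 < e / 2 by rewrite divr_gt0.
have /cvgrPdist_le/(_ _ e2)/near_distP[d1 d10 h1] := cf j i.
have /cvgrPdist_le/(_ _ e2)/near_distP[d2 d20 h3] := cf i j.
pose m := Num.min d (Num.min d1 d2).
have m0 : 0 < m by rewrite !lt_min d0 d10.
have s0 : 0 < m / 3 by rewrite divr_gt0.
have sm : 2 * (m / 3) < m by lra.
have lem y : `|y - x| < m -> [/\ U y, `|y - x| < d1 & `|y - x| < d2].
  by rewrite !lt_min => /andP[/hd ? /andP[]].
have [y ym Ey] := @schwarz_mean R n f x i j m (m / 3) s0 sm
  (fun y ym => let: And3 h _ _ := lem y ym in df i y h)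
  (fun y ym => let: And3 h _ _ := lem y ym in ddf i j y h).
have [z zm Ez] := @schwarz_mean R n f x j i m (m / 3) s0 sm
  (fun y ym => let: And3 h _ _ := lem y ym in df j y h)
  (fun y ym => let: And3 h _ _ := lem y ym in ddf j i y h).
have s2 : (m / 3) ^+ 2 != 0 by rewrite expf_neq0 // lt0r_neq0.
(* The second difference over the square is unchanged when [i] and [j] are exchanged, so the two
   mixed derivatives agree, though at two different points near [x]; continuity closes the gap. *)
have E : partial i (partial j f) z = partial j (partial i f) y.
  move: Ey Ez; rewrite (addrAC x (_ *: delta_mx 0 j)).
  set a := f (_ + _ + _); set b := f (_ + _); set c := f (_ + _).
  move: s2; clearbody a b c; move: (m / 3) (partial _ _ _) (partial _ _ _) (f x).
  clear; move=> t A B d t0 h1 h2; apply: (mulfI t0).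
  by rewrite -h1 -h2; ring.
have [_ _ /h3 hy] := lem y ym; have [_ /h1 hz _] := lem z zm.
have aux (a b c : R) : `|b - c| <= e / 2 -> `|a - c| <= e / 2 -> `|a - b| <= e.
  move=> h4 h5; rewrite -(subrKA c) [leRHS]splitr.
  by apply: le_trans (ler_normD _ _) _; rewrite (distrC c) lerD.
by rewrite -E in hy; exact: aux hy hz.
Qed.

(** * Second-order jets and the second derivative test *)

(** Twice differentiability at a single point, [g] being the gradient near [x]. Vectors are rows, so
    the derivative of [g] acts by [v *m H]. Unlike [Ck 2] the notion is pointwise, as is the
    comparison of two functions at a maximum of their difference. *)
Definition jet2 (R : realType) (n : nat) (f : 'rV[R]_n -> R) (x p : 'rV[R]_n)
    (H : 'M[R]_n) : Prop :=
  exists g : 'rV[R]_n -> 'rV[R]_n,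
    [/\ \forall y \near x, is_diff y f (fun v : 'rV[R]_n => dot v (g y)),
        g x = p & is_diff x g (fun v : 'rV[R]_n => v *m H)].

Section Jets.
Variables (R : realType) (n : nat).
Implicit Types (f : 'rV[R]_n -> R) (x p e : 'rV[R]_n) (H : 'M[R]_n) (U : set 'rV[R]_n).

Lemma Ck1_partial U f i : Ck 2 U f -> Ck 1 U (partial i f).
Proof. by move=> [_ h]; exact: (h i).2. Qed.

Lemma CkS k U (V : normedModType R) (f : 'rV[R]_n -> V) : Ck k.+1 U f -> Ck k U f.
Proof.
elim: k f => [|k IH] f [cf h]; split => // i.
by split; [exact: (h i).1|apply: IH; exact: (h i).2].
Qed.

Lemma jet2_Ck U f x : open U -> U x -> Ck 2 U f -> jet2 f x (egrad f x) (ehess f x).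
Proof.
move=> oU Ux f2; exists (egrad f); split => //.
  have : \forall y \near x, U y by exact: open_nbhs_nbhs.
  by apply: filterS => y Uy; apply: (C1_is_diff oU Uy); exact: CkS.
apply: is_diff_row => i.
have -> : (fun y : 'rV[R]_n => egrad f y 0 i : R) = partial i f.
  by apply/funext => y; rewrite mxE.
have -> : (fun v : 'rV[R]_n => (v *m ehess f x) 0 i : R) =
    (fun v : 'rV[R]_n => dot v (egrad (partial i f) x)).
  by apply/funext => v; rewrite mxE; apply: eq_bigr => j _; rewrite !mxE.
by apply: C1_is_diff oU Ux _; exact: Ck1_partial.
Qed.

Lemma is_diff_eqf (V W : normedModType R) (f f' df df' : V -> W) (x : V) :
  is_diff x f df -> f =1 f' -> df =1 df' -> is_diff x f' df'.
Proof. by move=> h /funext <- /funext <-. Qed.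

Lemma jet2D f1 f2 x p1 p2 H1 H2 : jet2 f1 x p1 H1 -> jet2 f2 x p2 H2 ->
  jet2 (fun y => f1 y + f2 y) x (p1 + p2) (H1 + H2).
Proof.
move=> [g1 [d1 <- dd1]] [g2 [d2 <- dd2]]; exists (fun y => g1 y + g2 y); split => //.
  apply: (@filterS2 _ (nbhs x) (nbhs_filter x) _ _ _ _ d1 d2) => y h1 h2.
  by apply: (is_diff_eqf (is_diffD h1 h2)) => // v; rewrite dotDr.
by apply: (is_diff_eqf (is_diffD dd1 dd2)) => // v; rewrite mulmxDr.
Qed.

Lemma jet2Z c f x p H : jet2 f x p H -> jet2 (fun y => c * f y) x (c *: p) (c *: H).
Proof.
move=> [g [d <- dd]]; exists (fun y => c *: g y); split => //.
  apply: filterS d => y h.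
  by apply: (is_diff_eqf (is_diffZ c h)) => // v; rewrite dotZr.
by apply: (is_diff_eqf (is_diffZ c dd)) => // v; rewrite -scalemxAr.
Qed.

Lemma jet2_cst c x : jet2 (fun=> c) x 0 0.
Proof.
exists (fun=> 0); split => //.
  apply: (@filterE _ (nbhs x) (nbhs_filter x)) => y; apply: (is_diff_eqf (is_diff_cst c y)) => // v.
  by rewrite dot0r.
by apply: (is_diff_eqf (is_diff_cst (0 : 'rV[R]_n) x)) => // v; rewrite mulmx0.
Qed.

Lemma is_diff_scale (a : 'rV[R]_n -> R) (g : 'rV[R]_n -> 'rV[R]_n) x p H :
  is_diff x a (fun v : 'rV[R]_n => dot v p) ->
  is_diff x g (fun v : 'rV[R]_n => v *m H) ->
  is_diff x (fun y => a y *: g y) (fun v : 'rV[R]_n => v *m (a x *: H + p^T *m g x)).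
Proof.
move=> da dg; apply: is_diff_row => i.
apply: (is_diff_eqf (is_diffM da (is_diff_component i dg))) => [y|v] /=.
  by rewrite !mxE.
have E : (v *m (p^T *m g x)) 0 i = dot v p * g x 0 i.
  by rewrite mulmxA mxE big_ord1 dotE.
rewrite mulmxDr -scalemxAr [RHS]mxE E [X in _ = X + _]mxE !fctE.
by rewrite /GRing.scale /= (mulrC (g x 0 i)).
Qed.

Lemma jet2_sqr f x p H : jet2 f x p H ->
  jet2 (fun y => f y ^+ 2) x ((2 * f x) *: p) ((2 * f x) *: H + 2 *: (p^T *m p)).
Proof.
move=> [g [d <- dd]]; exists (fun y => (2 * f y) *: g y); split => //.
  apply: filterS d => y h.
  apply: (is_diff_eqf (is_diffM h h)) => // v.
  by rewrite dotZr !fctE /GRing.scale /=; ring.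
have d2 := is_diffZ 2 (nbhs_singleton d).
have d3 : is_diff x (fun y : 'rV[R]_n => 2 * f y) (fun v : 'rV[R]_n => dot v (2 *: g x)).
  by apply: (is_diff_eqf d2) => // v; rewrite dotZr.
apply: (is_diff_eqf (is_diff_scale d3 dd)) => // v.
by rewrite linearZ /= -scalemxAl.
Qed.

Lemma jet2_sqdist x0 x : jet2 (fun y => sqnorm (y - x0)) x (2 *: (x - x0)) (2%:M).
Proof.
exists (fun y => 2 *: (y - x0)); split => //.
  apply: (@filterE _ (nbhs x) (nbhs_filter x)) => y.
  have h i := @is_diffB R 'rV[R]_n R _ _ _ _ y (is_diff_coord y i) (is_diff_cst (x0 0 i) y).
  have sum (r : seq 'I_n) : is_diff y
      (fun y : 'rV[R]_n => \sum_(i <- r) (y - x0) 0 i ^+ 2 : R)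
      (fun v : 'rV[R]_n => \sum_(i <- r) v 0 i * (2 *: (y - x0)) 0 i).
    elim: r => [|i r IH].
      apply: (is_diff_eqf (is_diff_cst (0:R) y)) => v; by rewrite big_nil.
    apply: (is_diff_eqf (is_diffD (is_diffM (h i) (h i)) IH)) => v.
      by rewrite big_cons !fctE !mxE expr2.
    by rewrite big_cons !fctE !mxE /GRing.scale /= subr0; congr (_ + _); ring.
  exact: sum.
apply: (is_diff_eqf (is_diffZ 2 (is_diffB (is_diff_id x) (is_diff_cst x0 x)))) => // v.
by rewrite !fctE subr0 mul_mx_scalar.
Qed.

(** Tested on lines through [x]. If the quadratic form were positive on [e], the slope
    [dot e (g (x + s *: e))], which vanishes at [s = 0], would be positive for small [s > 0], and
    the mean value theorem would push [f] above [f x]. *)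
Lemma jet2_max f x p H : jet2 f x p H -> (\forall y \near x, f y <= f x) ->
  p = 0 /\ forall e, dot (e *m H) e <= 0.
Proof.
move=> [g [df <- dg]] mx.
have [d d0 hd] : exists2 d : R, 0 < d & forall y, `|y - x| < d ->
    is_diff y f (fun v : 'rV[R]_n => dot v (g y)) /\ f y <= f x.
  by apply/near_distP; exact: (@filterI _ (nbhs x) (nbhs_filter x)).
have close e (t : R) : t * `|e| < d -> - d < t * `|e| -> `|x + t *: e - x| < d.
  by move=> h1 h2; rewrite [x + _]addrC addrK normrZ -(normr_id e) -normrM ltr_norml h1 h2.
have hD e (t : R) : t * `|e| < d -> - d < t * `|e| ->
    is_derive t (1:R) (fun s : R => f (x + s *: e)) (dot e (g (x + t *: e))).
  move=> h1 h2; have [dt _] := hd _ (close e t h1 h2).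
  have dt' := @ex_diff _ _ _ _ _ _ _ dt.
  have := is_derive_line (@diff_derivable _ _ _ _ _ e dt').
  by rewrite (deriveE _ dt') (@diff_val _ _ _ _ _ _ _ dt).
have key e : dot e (g x) = 0 /\ dot (e *m H) e <= 0.
  have [->|e0] := eqVneq e 0; first by rewrite dot0l dot0r.
  have ne : 0 < `|e| by rewrite normr_gt0.
  pose r := d / `|e|; have r0 : 0 < r by rewrite divr_gt0.
  have re : r * `|e| = d by rewrite divfK // lt0r_neq0.
  have itv (t : R) : - r < t < r -> t * `|e| < d /\ - d < t * `|e|.
    by move=> /andP[t1 t2]; rewrite -re -mulNr !ltr_pM2r.
  have g0 : dot e (g x) = 0.
    have D0 : is_derive (0:R) (1:R) (fun s : R => f (x + s *: e)) 0.
      apply: (@derive1_at_max _ _ (- r) r) => [|t|| t].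
      - by rewrite lerNl (le_trans _ (ltW r0)) // oppr_le0 ltW.
      - by rewrite in_itv /= => /itv[h1 h2]; case: (hD e t h1 h2).
      - by rewrite in_itv /= r0 oppr_lt0 r0.
      - rewrite in_itv /= scale0r addr0 => /itv[h1 h2].
        by have [] := hd _ (close e t h1 h2).
    have := hD e 0; rewrite mul0r oppr_lt0 => /(_ d0 d0) D1.
    have := @derive_val _ _ _ _ _ _ _ D1.
    by rewrite (@derive_val _ _ _ _ _ _ _ D0) scale0r addr0 => <-.
  split=> //; rewrite leNgt; apply/negP => k0.
  have dG : is_diff x (fun y : 'rV[R]_n => dot (g y) e)
      (fun v : 'rV[R]_n => dot (v *m H) e).
    exact: (is_diff_comp dg (is_diff_dot e (g x))).
  have eD : 'D_e (fun y : 'rV[R]_n => dot (g y) e : R) x = dot (e *m H) e.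
    by rewrite (deriveE _ (@ex_diff _ _ _ _ _ _ _ dG)) (@diff_val _ _ _ _ _ _ _ dG).
  have hG : derivable (fun y : 'rV[R]_n => dot (g y) e : R) (x + 0 *: e) e.
    by rewrite scale0r addr0; exact: diff_derivable (@ex_diff _ _ _ _ _ _ _ dG).
  have [] := is_derive_line hG.
  rewrite scale0r addr0 eD /derivable /derive => cG lG.
  have k2 : 0 < dot (e *m H) e / 2 by rewrite divr_gt0.
  have /cvgrPdist_lt/(_ _ k2) := cG; rewrite lG scale0r addr0 (dotC (g x)) g0.
  move=> /nbhs_ballP[c c0 hc].
  have Gpos (s : R) : 0 < s -> s < c -> 0 < dot e (g (x + s *: e)).
    move=> s0 sc; have := hc s; rewrite /ball /= sub0r normrN (gtr0_norm s0).
    move=> /(_ sc (lt0r_neq0 s0)).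
    rewrite /shift /= addr0 -[s%:A]/(s * 1) mulr1 subr0 ltr_norml => /andP[_].
    rewrite ltrBlDl -ltrBlDr => h.
    have : 0 < s^-1 *: dot (g (x + s *: e)) e by apply: lt_trans h; lra.
    by rewrite /GRing.scale /= pmulr_rgt0 ?invr_gt0 // dotC.
  pose s := Num.min c r / 2.
  have mcr : 0 < Num.min c r by rewrite lt_min c0 r0.
  have s0 : 0 < s by rewrite divr_gt0.
  have [sc sr] : s < c /\ s < r.
    have sm : s < Num.min c r by rewrite ltr_pdivrMr // ltr_pMr // ltr1n.
    by move: sm; rewrite lt_min => /andP[].
  have hs (t : R) : 0 <= t <= s -> is_derive t (1:R) (fun s : R => f (x + s *: e))
      (dot e (g (x + t *: e))).
    move=> /andP[t0 ts]; suff : - r < t < r by move=> /itv[]; exact: hD.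
    by rewrite (lt_le_trans _ t0) ?oppr_lt0 //= (le_lt_trans ts).
  have cF : {within `[0, s], continuous (fun s : R => f (x + s *: e))}.
    apply: derivable_within_continuous => t t01.
    by apply: (@ex_derive _ _ _ _ _ _ _ (hs t _)); move: t01; rewrite in_itv.
  have [t t0s Et] := MVT s0 (fun t ts => hs t (subset_itv_oo_cc ts)) cF.
  move: t0s; rewrite in_itv /= => /andP[t0 ts].
  have [h1 h2] : s * `|e| < d /\ - d < s * `|e|.
    by apply: itv; rewrite sr andbT (lt_trans _ s0) // oppr_lt0.
  have [_] := hd _ (close e s h1 h2).
  rewrite leNgt => /negP; apply.
  rewrite -subr_gt0; move: Et; rewrite scale0r addr0 subr0 => ->.
  by rewrite mulr_gt0 // Gpos // (lt_trans ts).
split => [|e]; last by have [] := key e.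
by apply/eqP; rewrite -sqnorm_eq0 -dotvv; apply/eqP; have [] := key (g x).
Qed.
End Jets.

(** * The translator equation in the ball model *)

(** Conformal factor of the ball model: the metric is [lam x ^+ 2] times the Euclidean one. *)
Definition lam (R : realType) (n : nat) (x : 'rV[R]_n) : R := 2 / (1 - sqnorm x).

(* The translator equation multiplied by [lam^4 (1 - |grad u|^2)^(3/2)], for the
   Euclidean gradient [p] and Hessian [H] of [u] at [x]; the terms in [dot x p]
   come from the Christoffel symbols of the conformal metric. *)
Definition translator_op (R : realType) (n : nat) (x p : 'rV[R]_n) (H : 'M[R]_n) : R :=
  (lam x ^+ 2 - sqnorm p) * (\tr H + (n%:R - 2) * lam x * dot x p - lam x ^+ 2)
  + dot (p *m H) p - lam x * dot x p * sqnorm p.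

Section Inner.
Variables (R : realType) (m : nat) (G : 'rV[R]_m -> 'M[R]_m) (x : 'rV[R]_m).

Lemma innerDl v1 v2 w : inner G x (v1 + v2) w = inner G x v1 w + inner G x v2 w.
Proof. by rewrite /inner !mulmxDl mxE. Qed.

Lemma innerZl c v w : inner G x (c *: v) w = c * inner G x v w.
Proof. by rewrite /inner -!scalemxAl mxE. Qed.

Lemma innerBl v1 v2 w : inner G x (v1 - v2) w = inner G x v1 w - inner G x v2 w.
Proof. by rewrite innerDl -scaleN1r innerZl mulN1r. Qed.

Lemma inner_suml (I : finType) (v : I -> 'rV[R]_m) w :
  inner G x (\sum_i v i) w = \sum_i inner G x (v i) w.
Proof. by rewrite /inner !mulmx_suml summxE. Qed.

(** Pairing with the metric cancels the inverse matrix in [christoffel] and leaves the Christoffel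
    symbols of the first kind. *)
Lemma inner_christoffel a b w : G x \in unitmx ->
  inner G x (christoffel G a b x) w =
  \sum_l (2^-1 * (partial a (fun y => G y b l) x + partial b (fun y => G y a l) x
     - partial l (fun y => G y a b) x)) * w 0 l.
Proof.
move=> uG; rewrite /inner /christoffel mulmxKV // dotE.
by apply: eq_bigr => l _; rewrite mxE.
Qed.

End Inner.

Section Hyp.
Variables (R : realType) (n : nat).
Implicit Types (x p v w : 'rV[R]_n) (z : 'rV[R]_(n + 1)) (s t : R).

Lemma lam_gt0 x : hyp x -> 0 < lam x.
Proof. by move=> hx; rewrite divr_gt0 // subr_gt0. Qed.

Lemma lam_ge2 x : hyp x -> 2 <= lam x.
Proof.
move=> hx; rewrite ler_pdivlMr ?subr_gt0 // ler_piMr //.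
by rewrite lerBlDr lerDl sqnorm_ge0.
Qed.

Lemma inner_ghyp x v w : inner ghyp x v w = lam x ^+ 2 * dot v w.
Proof. by rewrite /inner mul_mx_scalar -scalemxAl mxE dotE. Qed.

Lemma open_hyp : open (@hyp R n).
Proof.
have -> : @hyp R n = (@sqnorm R n) @^-1` [set s : R | s < 1] by [].
apply: open_comp; last exact: open_lt.
move=> x _; apply: differentiable_continuous.
have [g [/nbhs_singleton[h _] _ _]] := jet2_sqdist 0 x.
by move: h; under [X in differentiable X _]eq_fun do rewrite subr0.
Qed.

Lemma is_diff_sqnorm x :
  is_diff x (@sqnorm R n) (fun v : 'rV[R]_n => dot v (2 *: x)).
Proof.
have [g [/nbhs_singleton h]] := jet2_sqdist 0 x.
rewrite subr0 => gx _; move: h; rewrite gx.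
by under [X in is_diff_def _ X _ -> _]eq_fun do rewrite subr0.
Qed.

Lemma is_diff_lam x : hyp x ->
  is_diff x (@lam R n) (fun v : 'rV[R]_n => dot v (lam x ^+ 2 *: x)).
Proof.
move=> hx; have hx0 : 1 - sqnorm x != 0 by rewrite subr_eq0 gt_eqF.
have d1 := is_diffB (is_diff_cst (1 : R) x) (is_diff_sqnorm x).
have d2 : is_diff x (fun y : 'rV[R]_n => (1 - sqnorm y)^-1)
    (fun v : 'rV[R]_n => (1 - sqnorm x) ^- 2 * dot v (2 *: x)).
  apply: DiffDef; first exact: (differentiableV (@ex_diff _ _ _ _ _ _ _ d1)).
  rewrite (diffV (@ex_diff _ _ _ _ _ _ _ d1)) // (@diff_val _ _ _ _ _ _ _ d1).
  by apply/funext => v; rewrite /= !fctE sub0r /GRing.scale /= mulrNN.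
apply: (is_diff_eqf (is_diffZ 2 d2)) => // v.
rewrite fctE /GRing.scale /= !dotZr /lam exprMn exprVn.
ring.
Qed.

Lemma is_diff_lam2 x : hyp x ->
  is_diff x (fun y : 'rV[R]_n => lam y ^+ 2)
    (fun v : 'rV[R]_n => dot v ((2 * lam x ^+ 3) *: x)).
Proof.
move=> hx; have d := is_diff_lam hx.
apply: (is_diff_eqf (is_diffM d d)) => // v.
by rewrite !fctE /GRing.scale /= !dotZr; ring.
Qed.

Lemma glorentzE z : glorentz z = lam (lsubmx z) ^+ 2 *: block_mx 1%:M 0 0 0
    + block_mx 0 0 0 (-1)%:M :> 'M[R]_(n + 1).
Proof.
rewrite scale_block_mx add_block_mx !scaler0 !addr0 !add0r.
by rewrite /glorentz /ghyp -/(lam _) scalemx1.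
Qed.

Lemma inner_glorentz z v w s t :
  inner (@glorentz R n) z (row_mx v s%:M) (row_mx w t%:M)
  = lam (lsubmx z) ^+ 2 * dot v w - s * t.
Proof.
rewrite /inner /glorentz mul_row_block !mulmx0 addr0 add0r.
rewrite tr_row_mx mul_row_col mxE -/(inner ghyp _ _ _) inner_ghyp.
by rewrite mul_mx_scalar tr_scalar_mx mul_mx_scalar !mxE /= mulr1n; congr (_ + _); ring.
Qed.

Lemma glorentz_unit z : hyp (lsubmx z) -> glorentz z \in unitmx.
Proof.
move=> hz; have l0 : lam (lsubmx z) ^+ 2 != 0 by rewrite expf_neq0 // lt0r_neq0 // lam_gt0.
suff : glorentz z *m block_mx (lam (lsubmx z) ^- 2)%:M 0 0 (-1)%:M = 1%:M.
  by move/mulmx1_unit => [].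
rewrite /glorentz mulmx_block !mulmx0 !mul0mx !addr0 !add0r /ghyp -/(lam _).
by rewrite -!scalar_mxM divff // mulrNN mulr1 -scalar_mx_block.
Qed.

Lemma partial_glorentz z a b l : hyp (lsubmx z) ->
  partial a (fun y => glorentz y b l) z =
  dot (delta_mx 0 a) (row_mx ((2 * lam (lsubmx z) ^+ 3) *: lsubmx z) (0 : 'rV_1))
  * (block_mx 1%:M 0 0 0 : 'M[R]_(n + 1)) b l.
Proof.
move=> hz.
have dl : is_diff z (lsubmx : 'rV[R]_(n+1) -> 'rV[R]_n) (lsubmx : 'rV[R]_(n+1) -> 'rV[R]_n).
  apply: DiffDef; first exact: differentiable_lsubmx.
  by rewrite diff_lin //; exact: continuous_lsubmx.
have d1 := is_diff_comp dl (is_diff_lam2 hz).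
have d2 := is_diffD (is_diffM d1 (is_diff_cst ((block_mx 1%:M 0 0 0 : 'M[R]_(n + 1)) b l) z))
   (is_diff_cst ((block_mx 0 0 0 (-1)%:M : 'M[R]_(n + 1)) b l) z).
have d3 : is_diff z (fun y : 'rV[R]_(n + 1) => glorentz y b l : R)
  (fun v : 'rV[R]_(n + 1) => dot (lsubmx v) ((2 * lam (lsubmx z) ^+ 3) *: lsubmx z)
     * (block_mx 1%:M 0 0 0 : 'M[R]_(n + 1)) b l).
  apply: (is_diff_eqf d2) => [y|v]; first by rewrite glorentzE !fctE !mxE.
  by rewrite !fctE /GRing.scale /= mulr0 add0r addr0 mulrC.
rewrite /partial (deriveE _ (@ex_diff _ _ _ _ _ _ _ d3)) (@diff_val _ _ _ _ _ _ _ d3).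
congr (_ * _); rewrite -[in RHS](hsubmxK (delta_mx 0 a)).
by rewrite -!dotE tr_row_mx mul_row_col [in RHS]linear0 mulmx0 addr0.
Qed.

Lemma dot_block (v w : 'rV[R]_(n + 1)) :
  \sum_b \sum_l v 0 b * (block_mx 1%:M 0 0 0 : 'M[R]_(n + 1)) b l * w 0 l
  = dot (lsubmx v) (lsubmx w).
Proof.
transitivity ((v *m block_mx 1%:M 0 0 0 *m w^T) 0 0).
  rewrite mxE exchange_big; apply: eq_bigr => l _; rewrite mxE mulr_suml.
  by apply: eq_bigr => b _; rewrite !mxE.
rewrite -[in LHS](hsubmxK v) -[in LHS](hsubmxK w) tr_row_mx mul_row_block mul_row_col.
by rewrite !mulmx0 !addr0 mulmx1 mul0mx addr0 dotE.
Qed.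

(* Contraction of the ambient Christoffel symbols: only the horizontal parts of
   the vectors contribute, the metric being a product. *)
Lemma inner_christoffel_glorentz z (X Y N : 'rV[R]_(n + 1)) : hyp (lsubmx z) ->
  inner (@glorentz R n) z
    (\sum_a \sum_b (X 0 a * Y 0 b) *: christoffel (@glorentz R n) a b z) N =
  lam (lsubmx z) ^+ 3 *
    (dot (lsubmx X) (lsubmx z) * dot (lsubmx Y) (lsubmx N)
     + dot (lsubmx Y) (lsubmx z) * dot (lsubmx X) (lsubmx N)
     - dot (lsubmx N) (lsubmx z) * dot (lsubmx X) (lsubmx Y)).
Proof.
move=> hz; have uG := glorentz_unit hz.
(* [L] is the ambient gradient of [lam ^+ 2] and [J] the horizontal identity block. Derivatives of
   the metric split as [L 0 a * J b l], so each triple sum factors into two dot products. *)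
pose L : 'rV[R]_(n + 1) := row_mx ((2 * lam (lsubmx z) ^+ 3) *: lsubmx z) (0 : 'rV_1).
pose J : 'M[R]_(n + 1) := block_mx 1%:M 0 0 0.
have dL (v : 'rV[R]_(n + 1)) : dot v L = 2 * lam (lsubmx z) ^+ 3 * dot (lsubmx v) (lsubmx z).
  rewrite -[in LHS](hsubmxK v) /L -dotE tr_row_mx mul_row_col linear0 mulmx0 addr0.
  by rewrite dotE dotZr.
have PG a b l : partial a (fun y => glorentz y b l) z = L 0 a * J b l.
  by rewrite partial_glorentz // (dotC (delta_mx 0 a)) dot_delta.
transitivity (2^-1 * (dot X L * dot (lsubmx Y) (lsubmx N)
    + dot Y L * dot (lsubmx X) (lsubmx N) - dot N L * dot (lsubmx X) (lsubmx Y))); last first.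
  by rewrite !dL; field.
have termE a b l : (X 0 a * Y 0 b) * ((2^-1 * (L 0 a * J b l + L 0 b * J a l
      - L 0 l * J a b)) * N 0 l) = 2^-1 * ((X 0 a * L 0 a) * (Y 0 b * J b l * N 0 l)
        + (Y 0 b * L 0 b) * (X 0 a * J a l * N 0 l)
        - (N 0 l * L 0 l) * (X 0 a * J a b * Y 0 b)) by ring.
transitivity (\sum_a \sum_b \sum_l 2^-1 * ((X 0 a * L 0 a) * (Y 0 b * J b l * N 0 l)
        + (Y 0 b * L 0 b) * (X 0 a * J a l * N 0 l)
        - (N 0 l * L 0 l) * (X 0 a * J a b * Y 0 b))).
  rewrite inner_suml; apply: eq_bigr => a _.
  rewrite inner_suml; apply: eq_bigr => b _.
  rewrite innerZl inner_christoffel // mulr_sumr; apply: eq_bigr => l _.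
  by rewrite !PG termE.
rewrite -!dot_block /dot -/J.
under eq_bigr => a _ do under eq_bigr => b _ do
  rewrite -mulr_sumr sumrB big_split /=.
under eq_bigr => a _ do rewrite -mulr_sumr sumrB big_split /=.
rewrite -mulr_sumr sumrB big_split /=; congr (_ * (_ + _ - _)).
- rewrite mulr_suml; apply: eq_bigr => a _; rewrite mulr_sumr.
  by apply: eq_bigr => b _; rewrite mulr_sumr.
- rewrite mulr_suml exchange_big; apply: eq_bigr => b _ /=; rewrite mulr_sumr.
  by apply: eq_bigr => a _; rewrite mulr_sumr.
- rewrite mulr_suml; under eq_bigr => a _ do rewrite exchange_big.
  rewrite exchange_big; apply: eq_bigr => l _ /=; rewrite mulr_sumr.
  by apply: eq_bigr => a _; rewrite mulr_sumr.
Qed.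
End Hyp.

(** * Mean curvature of a space-like graph *)

Section Graph.
Variables (R : realType) (n : nat).
Implicit Types (x p v w : 'rV[R]_n) (O : set 'rV[R]_n) (u : 'rV[R]_n -> R).

Lemma is_derive_row_mx (V : normedModType R) (a : V -> 'rV[R]_n) (b : V -> R)
    (y v : V) da db : is_derive y v a da -> is_derive y v b db ->
  is_derive y v (fun z => row_mx (a z) (b z)%:M : 'rV[R]_(n + 1)) (row_mx da db%:M).
Proof.
move=> [ha ea] [hb eb].
have entry j : is_derive y v (fun z => (row_mx (a z) (b z)%:M : 'rV[R]_(n + 1)) 0 j : R)
    ((row_mx da db%:M : 'rV[R]_(n + 1)) 0 j).
  case: (splitP j) => k jk.
    have -> : j = lshift 1 k by exact/val_inj.
    under eq_fun do rewrite row_mxEl.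
    rewrite row_mxEl; split; first exact: ((derivable_mxP a y v).1 ha 0 k).
    by rewrite -ea derive_mx // mxE.
  have -> : j = rshift n k by exact/val_inj.
  under eq_fun do rewrite row_mxEr mxE ord1 mulr1n.
  by rewrite row_mxEr mxE ord1 mulr1n; split.
have dm : derivable (fun z => row_mx (a z) (b z)%:M : 'rV[R]_(n + 1)) y v.
  by apply/derivable_mxP => i j; rewrite (ord1 i); case: (entry j).
split => //; apply/rowP => j; rewrite derive_mx // mxE.
by case: (entry j).
Qed.

Variables (O : set 'rV[R]_n) (u : 'rV[R]_n -> R).
Hypotheses (oO : open O) (u2 : Ck 2 O u).

Lemma partial_graph i x : O x ->
  partial i (graph_of u) x = row_mx (delta_mx 0 i) (egrad u x 0 i)%:M.
Proof.
move=> Ox; have du : is_derive x (delta_mx 0 i) u (egrad u x 0 i).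
  by rewrite mxE; apply: derivableP; exact: (u2.2 i).1.
by have [_ <-] := is_derive_row_mx (is_derive_id x (delta_mx 0 i)) du.
Qed.

Lemma partial2_graph i j x : O x ->
  partial i (partial j (graph_of u)) x = row_mx 0 (ehess u x i j)%:M.
Proof.
move=> Ox; have du : is_derive x (delta_mx 0 i) (partial j u) (ehess u x i j).
  by rewrite mxE; apply: derivableP; exact: ((u2.2 j).2.2 i).1.
have [_ <-] := is_derive_row_mx (is_derive_cst (delta_mx 0 j : 'rV[R]_n) x (delta_mx 0 i)) du.
rewrite {1}/partial; apply: near_eq_derive.
have nO : \forall y \near x, O y by exact: open_nbhs_nbhs.
by apply: filterS nO => y Oy; rewrite partial_graph // mxE.
Qed.

Lemma bilinear_sum (p : 'rV[R]_n) (H : 'M[R]_n) :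
  dot (p *m H) p = \sum_i \sum_j p 0 i * p 0 j * H i j.
Proof.
rewrite /dot exchange_big; apply: eq_bigr => j _; rewrite mxE mulr_suml.
by apply: eq_bigr => i _; rewrite mulrAC.
Qed.

Hypotheses (Ohyp : O `<=` hyp) (usp : spacelike O u).

Lemma spacelike_sqnorm x : O x -> sqnorm (egrad u x) < lam x ^+ 2.
Proof.
move=> Ox; have l0 := lam_gt0 (Ohyp Ox); have := usp Ox.
have -> : grad ghyp u x = lam x ^- 2 *: egrad u x.
  by rewrite /grad /ghyp invmx_scalar mul_mx_scalar -exprVn.
rewrite /tnorm inner_ghyp dotZl dotZr dotvv.
have l2 : lam x ^+ 2 != 0 by rewrite expf_neq0 // lt0r_neq0.
rewrite mulVKf // => h.
have h2 : lam x ^- 2 * sqnorm (egrad u x) < 1.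
  rewrite ltNge; apply/negP => h1; move: h; rewrite ltNge => /negP; apply.
  by rewrite -sqrtr1 ler_wsqrtr.
by move: h2; rewrite mulrC ltr_pdivrMr ?mul1r // exprn_gt0.
Qed.

(** The induced metric is the rank-one perturbation [(lam x ^+ 2)%:M - p^T *m p], inverted by the
    Sherman-Morrison formula; its denominator is nonzero because the graph is space-like. *)
Lemma invmx_first_form x : O x ->
  let p := egrad u x in
  invmx (first_form (@glorentz R n) (graph_of u) x) =
  lam x ^- 2 *: (1%:M + (lam x ^+ 2 - sqnorm p)^-1 *: (p^T *m p)).
Proof.
move=> Ox p; have W0 : lam x ^+ 2 - sqnorm p != 0.
  by rewrite lt0r_neq0 // subr_gt0 spacelike_sqnorm.
have l2 : lam x ^+ 2 != 0 by rewrite expf_neq0 // lt0r_neq0 // lam_gt0 //; exact: Ohyp.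
have -> : first_form (@glorentz R n) (graph_of u) x = (lam x ^+ 2)%:M - p^T *m p.
  apply/matrixP => i j; rewrite [LHS]mxE !partial_graph // inner_glorentz row_mxKl.
  by rewrite dot_delta !mxE big_ord1 !mxE eqxx /= (eq_sym j) mulr_natr.
set A := _ - _; set B := _ *: _.
have AB : A *m B = 1%:M.
  rewrite /A /B -scalemxAr mulmxDr mulmx1 -scalemxAr mulmxBl mul_scalar_mx.
  have -> : p^T *m p *m (p^T *m p) = sqnorm p *: (p^T *m p).
    rewrite mulmxA -(mulmxA _ p) [p *m p^T]mx11_scalar dotE dotvv.
    by rewrite mul_mx_scalar -scalemxAl.
  rewrite -scalerBl scalerA mulVf // scale1r subrK.
  by rewrite -scalemx1 scalerA mulVf // scale1r.
have [uA _] := mulmx1_unit AB.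
by rewrite -[RHS](mulKmx uA) AB mulmx1.
Qed.

(** The vector equation is paired with one normal vector [N]. Tangential projections vanish against
    [N], so [second_form] may be replaced by [ambient_deriv] and [normal_proj] of [dt] by [dt]
    itself. *)
Lemma translator_op0 x : O x -> translator O u ->
  translator_op x (egrad u x) (ehess u x) = 0.
Proof.
move=> Ox /(_ x Ox) tr; set p := egrad u x; set H := ehess u x.
have W0 : lam x ^+ 2 - sqnorm p != 0.
  by rewrite lt0r_neq0 // subr_gt0 spacelike_sqnorm.
have hx := Ohyp Ox; have l0 : lam x != 0 by rewrite lt0r_neq0 // lam_gt0.
have l2 : lam x ^+ 2 != 0 by rewrite expf_neq0.
pose N : 'rV[R]_(n + 1) := row_mx (lam x ^- 2 *: p) 1%:M.
have NF i : inner (@glorentz R n) (graph_of u x) (partial i (graph_of u) x) N = 0.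
  rewrite partial_graph // inner_glorentz row_mxKl dotC dot_delta mxE mulr1.
  by rewrite mulVKf // subrr.
have NP (w : 'rV[R]_(n + 1)) : inner (@glorentz R n) (graph_of u x)
    (normal_proj (@glorentz R n) (graph_of u) x w) N = inner (@glorentz R n) (graph_of u x) w N.
  rewrite /normal_proj innerBl inner_suml big1 ?subr0 // => i _.
  by rewrite inner_suml big1 // => j _; rewrite innerZl NF mulr0.
(* [M] is the second fundamental form paired with [N]. The inverse first form splits its trace into
   the Euclidean trace and a term in [p 0 i * p 0 j]. *)
pose M i j := lam x * (x 0 i * p 0 j + x 0 j * p 0 i - (i == j)%:R * dot x p) - H i j.
have AD i j : inner (@glorentz R n) (graph_of u x)
    (ambient_deriv (@glorentz R n) (graph_of u) i j x) N = M i j.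
  rewrite /ambient_deriv innerDl partial2_graph // inner_glorentz dot0l.
  rewrite inner_christoffel_glorentz ?row_mxKl // !partial_graph // !row_mxKl.
  rewrite !dot_deltal !dotZl !mxE eqxx /= -/p (dotC p).
  rewrite /M ![p 0 _]mxE [H i j]mxE; field.
  exact: l0.
have := congr1 (fun w : 'rV[R]_(n + 1) => inner (@glorentz R n) (graph_of u x) w N) tr.
rewrite NP inner_glorentz row_mxKl dot0l mulr0 sub0r mulr1.
rewrite /mean_curvature inner_suml.
have -> : \sum_i inner (@glorentz R n) (graph_of u x)
   (\sum_j invmx (first_form (@glorentz R n) (graph_of u) x) i j
      *: second_form (@glorentz R n) (graph_of u) i j x) N
  = lam x ^- 2 * ((\sum_i \sum_j (i == j)%:R * M i j)
     + (lam x ^+ 2 - sqnorm p)^-1 * \sum_i \sum_j p 0 i * p 0 j * M i j).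
  rewrite mulr_sumr -big_split mulr_sumr; apply: eq_bigr => i _ /=.
  rewrite inner_suml mulr_sumr -big_split mulr_sumr; apply: eq_bigr => j _ /=.
  rewrite innerZl /second_form NP AD invmx_first_form // -/p.
  rewrite !mxE big_ord1 !mxE; ring.
have -> : \sum_i \sum_j (i == j)%:R * M i j = lam x * ((2 - n%:R) * dot x p) - \tr H.
  transitivity (\sum_i M i i).
    apply: eq_bigr => i _; rewrite (bigD1 i) //= eqxx mul1r big1 ?addr0 // => j ji.
    by rewrite eq_sym (negbTE ji) mul0r.
  rewrite /M sumrB -mulr_sumr -/(\tr H); congr (_ * _ - _).
  under eq_bigr do rewrite eqxx mul1r.
  rewrite sumrB big_split /= sumr_const card_ord -/(dot x p) -mulr_natl; ring.
have -> : \sum_i \sum_j p 0 i * p 0 j * M i j =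
    lam x * (dot x p * sqnorm p) - dot (p *m H) p.
  have E1 : \sum_i \sum_j p 0 i * x 0 i * (p 0 j * p 0 j) = dot x p * sqnorm p.
    rewrite -dotvv dotC {2}/dot mulr_suml; apply: eq_bigr => i _.
    by rewrite mulr_sumr.
  have E2 : \sum_i \sum_j p 0 i * p 0 i * (x 0 j * p 0 j) = sqnorm p * dot x p.
    rewrite -dotvv {1}/dot mulr_suml; apply: eq_bigr => i _.
    by rewrite mulr_sumr.
  have E3 : \sum_i \sum_j (i == j)%:R * (p 0 i * p 0 j) = sqnorm p.
    rewrite -dotvv; apply: eq_bigr => i _.
    rewrite (bigD1 i) //= eqxx mul1r big1 ?addr0 // => j ji.
    by rewrite eq_sym (negbTE ji) mul0r.
  transitivity (lam x * (\sum_i \sum_j p 0 i * x 0 i * (p 0 j * p 0 j)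
     + \sum_i \sum_j p 0 i * p 0 i * (x 0 j * p 0 j)
     - dot x p * \sum_i \sum_j (i == j)%:R * (p 0 i * p 0 j)) - dot (p *m H) p).
    rewrite bilinear_sum [X in _ = _ * (_ - X) - _]mulr_sumr -big_split -sumrB.
    rewrite mulr_sumr -sumrB; apply: eq_bigr => i _ /=.
    rewrite [X in _ = _ * (_ - X) - _]mulr_sumr -big_split -sumrB.
    rewrite mulr_sumr -sumrB; apply: eq_bigr => j _ /=.
    rewrite /M; ring.
  by rewrite E1 E2 E3; ring.
rewrite /translator_op => E.
have E' : (lam x ^+ 2 - sqnorm p)^-1 * (lam x * (dot x p * sqnorm p) - dot (p *m H) p)
   = - lam x ^+ 2 - lam x * ((2 - n%:R) * dot x p) + \tr H.
  apply: (mulfI (invr_neq0 l2)); move: E.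
  set a := _^-1 * (_ - _); set b := lam x * (_ * _) => E.
  by rewrite (_ : a = (b - \tr H + a) - (b - \tr H)) ?mulrBr ?E; [field|ring].
move: E' => /(congr1 (fun a => (lam x ^+ 2 - sqnorm p) * a)); rewrite mulVKf // => E'.
transitivity (- ((lam x ^+ 2 - sqnorm p) * (- lam x ^+ 2 - lam x * ((2 - n%:R) * dot x p) + \tr H))
  + (lam x ^+ 2 - sqnorm p) * (\tr H + (n%:R - 2) * lam x * dot x p - lam x ^+ 2)).
  rewrite -E'; ring.
ring.
Qed.
End Graph.

(** * Isometries *)

(** The equation at one point, asked of some jet of [f] there, so that it passes through composition
    with an isometry point by point. The bound on [sqnorm p] is the space-like condition for the
    Euclidean gradient. *)
Definition translator_jet (R : realType) (n : nat) (f : 'rV[R]_n -> R) (x : 'rV[R]_n) :=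
  exists p H, [/\ jet2 f x p H, sqnorm p < lam x ^+ 2 & translator_op x p H = 0].

Lemma near_eq_continuous (R : realType) (n : nat) (V : normedModType R)
    (f g : 'rV[R]_n -> V) (x : 'rV[R]_n) :
  (\forall y \near x, f y = g y) -> {for x, continuous f} -> {for x, continuous g}.
Proof.
move=> fg cf; have E : f x = g x := nbhs_singleton fg.
rewrite /prop_for /continuous_at -E.
apply: cvg_trans cf; apply: (@near_eq_cvg _ _ (nbhs x) (nbhs_filter x)).
exact: fg.
Qed.

Lemma Ck_eq (R : realType) (n k : nat) (V : normedModType R) (U : set 'rV[R]_n)
    (f g : 'rV[R]_n -> V) :
  open U -> (forall x, U x -> f x = g x) -> Ck k U f -> Ck k U g.
Proof.
move=> oU; elim: k f g => [|k IH] f g fg [cf h];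
  have nfg x : U x -> \forall y \near x, f y = g y by
    move=> Ux; have nU : \forall y \near x, U y by [exact: open_nbhs_nbhs];
    apply: (@filterS _ (nbhs x) (nbhs_filter x) _ _ _ nU) => y Uy; exact: fg.
  by split => // x Ux; exact: near_eq_continuous (nfg x Ux) (cf x Ux).
split=> [x Ux|i]; first exact: near_eq_continuous (nfg x Ux) (cf x Ux).
have [df Cf] := h i; split => [x Ux|].
  exact: near_eq_derivable (nfg x Ux) (df x Ux).
by apply: IH Cf => x Ux; apply: near_eq_derive; exact: nfg.
Qed.

Lemma continuous_component (R : realType) (n m : nat) (s : 'rV[R]_n -> 'rV[R]_m) (a : 'I_m)
    (x : 'rV[R]_n) : {for x, continuous s} -> {for x, continuous (fun x => s x 0 a)}.
Proof.
move=> cs; rewrite /prop_for /continuous_at.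
have h : {for s x, continuous (fun M : 'rV[R]_m => M 0 a : R)} by exact: coord_continuous.
exact: (continuous_comp cs h).
Qed.

Lemma Ck_component (R : realType) (n m k : nat) (U : set 'rV[R]_n)
    (s : 'rV[R]_n -> 'rV[R]_m) (a : 'I_m) :
  open U -> Ck k U s -> Ck k U (fun x => s x 0 a).
Proof.
move=> oU; elim: k s => [|k IH] s [cs h].
  split => // x Ux.
  exact: continuous_component (cs x Ux).
split=> [x Ux|i].
  exact: continuous_component (cs x Ux).
have [ds Cs] := h i; split => [x Ux|].
  by have := (derivable_mxP s x (delta_mx 0 i)).1 (ds x Ux) 0 a.
apply: Ck_eq (IH _ Cs) => // x Ux.
by rewrite /partial derive_mx ?mxE //; exact: ds.
Qed.

Lemma is_diff_big (R : realType) (V W : normedModType R) (I : finType) (x : V)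
    (f df : I -> V -> W) : (forall a, is_diff x (f a) (df a)) ->
  is_diff x (fun y => \sum_a f a y) (fun v => \sum_a df a v).
Proof.
move=> h; elim: (index_enum I) => [|a r IH].
  by apply: (is_diff_eqf (is_diff_cst (0 : W) x)) => y; rewrite big_nil.
by apply: (is_diff_eqf (is_diffD (h a) IH)) => y; rewrite big_cons.
Qed.

(** Second-order chain rule. [D] holds the entries of the Jacobian of [s] and [E] their gradients at
    [x], so the last matrix contracts the second derivatives of [s] with [p]; for isometries
    [gram_cyclic] evaluates it. *)
Lemma jet2_comp (R : realType) (n : nat) (s : 'rV[R]_n -> 'rV[R]_n)
    (U : set 'rV[R]_n) (D : 'I_n -> 'I_n -> 'rV[R]_n -> R)
    (E : 'I_n -> 'I_n -> 'rV[R]_n) (f : 'rV[R]_n -> R) (x p : 'rV[R]_n) (H : 'M[R]_n) :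
  open U -> U x ->
  (forall y, U y -> is_diff y s (fun v : 'rV[R]_n => v *m \matrix_(i, a) D i a y)) ->
  (forall l a, is_diff x (D l a) (fun v : 'rV[R]_n => dot v (E l a))) ->
  jet2 f (s x) p H ->
  jet2 (f \o s) x (p *m (\matrix_(i, a) D i a x)^T)
    ((\matrix_(i, a) D i a x) *m H *m (\matrix_(i, a) D i a x)^T
     + \matrix_(k, i) (\sum_a p 0 a * E i a 0 k)).
Proof.
move=> oU Ux ds dD [g [df <- dg]].
exists (fun y => g (s y) *m (\matrix_(i, a) D i a y)^T); split => //.
  have nU : \forall y \near x, U y by exact: open_nbhs_nbhs.
  have sc : {for x, continuous s}.
    by apply: differentiable_continuous; have [] := ds x Ux.
  have nf : \forall y \near x, is_diff (s y) f (fun v : 'rV[R]_n => dot v (g (s y))).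
    exact: (sc _ df).
  apply: (@filterS2 _ (nbhs x) (nbhs_filter x) _ _ _ _ nU nf) => y Uy hy.
  apply: (is_diff_eqf (is_diff_comp (ds y Uy) hy)) => // v.
  by rewrite /= dot_mulmx.
apply: is_diff_row => i.
have dgs a := is_diff_component a (is_diff_comp (ds x Ux) dg).
apply: (is_diff_eqf (is_diff_big (fun a => is_diffM (dgs a) (dD i a)))) => [y|v].
  by rewrite mxE; apply: eq_bigr => a _; rewrite !mxE.
set J := \matrix_(i, a) D i a x.
have -> : (v *m (J *m H *m J^T + \matrix_(k, i) (\sum_a g (s x) 0 a * E i a 0 k))) 0 i
   = (v *m J *m H *m J^T) 0 i + \sum_k v 0 k * (\sum_a g (s x) 0 a * E i a 0 k).
  rewrite mulmxDr mxE !mulmxA; congr (_ + _); rewrite mxE.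
  by apply: eq_bigr => k _; rewrite mxE.
rewrite [X in _ = X + _]mxE; under [X in _ = _ + X]eq_bigr do rewrite mulr_sumr.
rewrite exchange_big -big_split; apply: eq_bigr => a _ /=.
rewrite !fctE /GRing.scale /= addrC; congr (_ + _).
  by rewrite [J^T a i]mxE [J i a]mxE mulrC.
by rewrite /dot mulr_sumr; apply: eq_bigr => k _; ring.
Qed.

(** * Invariance of the equation under isometries *)

Section Pullback.
Variables (R : realType) (n : nat) (s : 'rV[R]_n -> 'rV[R]_n).
Hypotheses (s_smooth : smooth hyp s) (s_hyp : forall x, hyp x -> hyp (s x)).
Hypothesis s_isom : forall x v w, hyp x ->
  inner ghyp (s x) ('D_v s x) ('D_w s x) = inner ghyp x v w.

Definition jac (x : 'rV[R]_n) : 'M[R]_n :=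
  \matrix_(i, a) partial i (fun y => s y 0 a) x.

Let sC (a : 'I_n) k : Ck k hyp (fun y => s y 0 a).
Proof. by apply: Ck_component (s_smooth k); exact: open_hyp. Qed.

Lemma is_diff_jac x : hyp x -> is_diff x s (fun v : 'rV[R]_n => v *m jac x).
Proof.
move=> hx; apply: is_diff_row => a.
apply: (is_diff_eqf (C1_is_diff (@open_hyp R n) hx (sC a 1))) => // v.
by rewrite mxE; apply: eq_bigr => i _; rewrite !mxE.
Qed.

Lemma derive_jac x v : hyp x -> 'D_v s x = v *m jac x.
Proof.
move=> hx; have h := is_diff_jac hx.
by rewrite (deriveE _ (@ex_diff _ _ _ _ _ _ _ h)) (@diff_val _ _ _ _ _ _ _ h).
Qed.

(** An isometry of the conformally flat ball is a Euclidean conformal map; this is the square of its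
    conformal factor. *)
Definition confsq (x : 'rV[R]_n) : R := lam x ^+ 2 / lam (s x) ^+ 2.

Lemma confsq_gt0 x : hyp x -> 0 < confsq x.
Proof.
by move=> hx; rewrite divr_gt0 // exprn_gt0 // lam_gt0 //; exact: s_hyp.
Qed.

Lemma confsqE x : hyp x -> lam x ^+ 2 = confsq x * lam (s x) ^+ 2.
Proof.
move=> hx; rewrite divfK // lt0r_neq0 // exprn_gt0 // lam_gt0 //; exact: s_hyp.
Qed.

Lemma dot_jac x v w : hyp x -> dot (v *m jac x) (w *m jac x) = confsq x * dot v w.
Proof.
move=> hx; have := s_isom v w hx; rewrite !inner_ghyp !derive_jac // (confsqE hx).
have l0 : lam (s x) ^+ 2 != 0.
  by rewrite lt0r_neq0 // exprn_gt0 // lam_gt0 //; exact: s_hyp.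
by move=> E; apply: (mulfI l0); rewrite E -mulrA mulrCA.
Qed.

Lemma jac_tr x : hyp x -> jac x *m (jac x)^T = (confsq x)%:M.
Proof.
move=> hx; apply/matrixP => i j.
have := dot_jac (delta_mx 0 i) (delta_mx 0 j) hx.
rewrite dot_delta -!rowE [X in _ = _ * X -> _]mxE /= eq_sym => E.
rewrite [RHS]mxE -mulr_natr -E mxE.
by apply: eq_bigr => a _; rewrite !mxE.
Qed.

Lemma tr_jac x : hyp x -> (jac x)^T *m jac x = (confsq x)%:M.
Proof.
move=> hx; have c0 : confsq x != 0 by rewrite lt0r_neq0 // confsq_gt0.
have : jac x *m ((confsq x)^-1 *: (jac x)^T) = 1%:M.
  by rewrite -scalemxAr jac_tr // scale_scalar_mx mulVf.
move=> /mulmx1C; rewrite -scalemxAl => /(congr1 (fun A => confsq x *: A)).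
by rewrite /= scalerA mulfV // scale1r scalemx1.
Qed.

(* Half the logarithmic gradient of [confsq]. *)
Definition confgrad (x : 'rV[R]_n) : 'rV[R]_n :=
  lam x *: x - lam (s x) *: (s x *m (jac x)^T).

(** Rather than a quotient, the Gram relation multiplied by [lam (s y) ^+ 2] is differentiated along
    the [k] axis; both sides then involve only [lam ^+ 2] and entries of the Jacobian. *)
Lemma gram_deriv (D : 'I_n -> 'I_n -> 'rV[R]_n -> R) (E : 'I_n -> 'I_n -> 'rV[R]_n)
    x i j k : hyp x ->
  (forall l a, is_diff x (D l a) (fun v : 'rV[R]_n => dot v (E l a))) ->
  (forall y, hyp y -> \sum_a D i a y * D j a y = (i == j)%:R * confsq y) ->
  \sum_a (E i a 0 k * D j a x + E j a 0 k * D i a x)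
  = (i == j)%:R * (2 * confsq x * confgrad x 0 k).
Proof.
move=> hx d1 ij.
have dp a := is_diffM (d1 i a) (d1 j a).
have dl := is_diff_lam2 (s_hyp hx).
have d2 := is_diffM (is_diff_big dp) (is_diff_comp (is_diff_jac hx) dl).
have d3 := is_diffZ (i == j)%:R (is_diff_lam2 hx).
have hE : \forall y \near x, (\sum_a D i a y * D j a y) * lam (s y) ^+ 2
    = (i == j)%:R * lam y ^+ 2.
  have nU : \forall y \near x, hyp y by apply: open_nbhs_nbhs; split => //; exact: open_hyp.
  apply: (@filterS _ (nbhs x) (nbhs_filter x) _ _ _ nU) => y hy.
  by rewrite (confsqE hy) mulrA ij.
have d2' : is_diff x (fun y : 'rV[R]_n => (\sum_a D i a y * D j a y) * lam (s y) ^+ 2)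
   (fun v : 'rV[R]_n => (i == j)%:R * confsq x * (2 * lam (s x) ^+ 3 * dot v (s x *m (jac x)^T))
     + lam (s x) ^+ 2 * \sum_a (D i a x * dot v (E j a) + D j a x * dot v (E i a))).
  apply: (is_diff_eqf d2) => // v.
  by rewrite !fctE /GRing.scale /= dotZr dot_mulmx -ij.
have := near_eq_derive (delta_mx 0 k) hE.
rewrite (deriveE _ (@ex_diff _ _ _ _ _ _ _ d2')) (@diff_val _ _ _ _ _ _ _ d2').
rewrite (deriveE _ (@ex_diff _ _ _ _ _ _ _ d3)) (@diff_val _ _ _ _ _ _ _ d3).
rewrite fctE /GRing.scale /= dotZr !dot_deltal.
have -> : \sum_a (D i a x * dot (delta_mx 0 k) (E j a) + D j a x * dot (delta_mx 0 k) (E i a))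
    = \sum_a (E i a 0 k * D j a x + E j a 0 k * D i a x).
  by apply: eq_bigr => a _; rewrite !dot_deltal; ring.
set X := \sum_a _ => EE.
have l0 : lam (s x) ^+ 2 != 0.
  by rewrite lt0r_neq0 // exprn_gt0 // lam_gt0 //; exact: s_hyp.
apply: (mulfI l0); rewrite /confgrad ![(_ - _ : 'rV_n) 0 k]mxE [(_ *: x) 0 k]mxE.
rewrite [(- _ : 'rV_n) 0 k]mxE [(_ *: _ : 'rV_n) 0 k]mxE.
set w := (s x *m (jac x)^T) 0 k in EE *.
have := confsqE hx => E2.
transitivity ((i == j)%:R * (2 * lam x ^+ 3 * x 0 k)
    - (i == j)%:R * confsq x * (2 * lam (s x) ^+ 3 * w)).
  by rewrite -EE addrAC subrr add0r.
have -> : lam x ^+ 3 = lam x * lam x ^+ 2 by rewrite -exprS.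
rewrite E2; ring.
Qed.

(* Differentiating [jac x *m (jac x)^T = confsq x] and permuting the indices
   cyclically determines the second derivatives of an isometry, as for the
   Christoffel symbols. *)
Lemma gram_cyclic (D : 'I_n -> 'I_n -> R) (E : 'I_n -> 'I_n -> 'rV[R]_n)
    x (q : 'rV[R]_n) (nu : 'rV[R]_n) (c : R) : c != 0 ->
  (forall l k a, E l a 0 k = E k a 0 l) ->
  (forall i j k, \sum_a (E i a 0 k * D j a + E j a 0 k * D i a)
     = (i == j)%:R * (2 * c * nu 0 k)) ->
  (\matrix_(i, a) D i a)^T *m (\matrix_(i, a) D i a) = c%:M ->
  x = q *m (\matrix_(i, a) D i a)^T ->
  \matrix_(k, i) (\sum_a q 0 a * E i a 0 k) =
  nu^T *m x + x^T *m nu - (dot nu x)%:M.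
Proof.
move=> c0 Esym gd DD xE.
pose A i j k := \sum_a E i a 0 j * D k a.
have AC i j k : A i j k = A j i k by apply: eq_bigr => a _; rewrite Esym.
have AE i j k : A i j k = c * (nu 0 i * (j == k)%:R + nu 0 j * (i == k)%:R
    - nu 0 k * (i == j)%:R).
  have g i' j' k' : A i' k' j' + A j' k' i' = (i' == j')%:R * (2 * c * nu 0 k').
    by rewrite -gd -big_split.
  have h1 := g j k i; have h2 := g i k j; have h3 := g i j k.
  rewrite (AC k i j) (AC j i k) in h1; rewrite (AC k j i) in h2.
  have : 2 * A i j k = (A i j k + A i k j) + (A i j k + A j k i) - (A i k j + A j k i).
    ring.
  rewrite h1 h2 h3 => h; apply: (@mulfI _ 2) => //; rewrite h; ring.
(* The Jacobian is invertible up to the factor [c], so [q] is recovered from [x], and the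
   contraction of [E] with [q] becomes one of [A] with [x]. *)
have qE : q = c^-1 *: (x *m (\matrix_(i, a) D i a)).
  by rewrite xE -mulmxA DD mul_mx_scalar scalerA mulVf // scale1r.
apply/matrixP => k i; rewrite mxE.
transitivity (c^-1 * \sum_l x 0 l * A i k l).
  rewrite mulr_sumr {1}qE.
  under eq_bigr => a _ do rewrite mxE mxE -mulrA mulr_suml mulr_sumr.
  rewrite exchange_big; apply: eq_bigr => l _ /=; rewrite /A mulr_sumr mulr_sumr.
  by apply: eq_bigr => a _; rewrite !mxE; congr (_ * _); ring.
have EL l : x 0 l * A i k l = c * (nu 0 k * ((i == l)%:R * x 0 l)
  + nu 0 i * ((k == l)%:R * x 0 l) - (i == k)%:R * (nu 0 l * x 0 l)).
  rewrite AE; ring.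
under eq_bigr => l _ do rewrite EL.
have pick m : \sum_l (m == l)%:R * x 0 l = x 0 m.
  rewrite (bigD1 m) //= eqxx mul1r big1 ?addr0 // => l lm.
  by rewrite eq_sym (negbTE lm) mul0r.
rewrite -mulr_sumr mulKf // sumrB big_split /= -!mulr_sumr !pick -/(dot nu x).
by rewrite !mxE !big_ord1 !mxE (eq_sym i); ring.
Qed.



(** The operator at [x] is [confsq x ^+ 2] times the one at [s x]. With [nu] the vector [confgrad x]
    and [p'] the new gradient, the extra Hessian term has trace [(2 - n%:R) * dot nu p'] and
    quadratic form [dot nu p' * sqnorm p'] on [p']. These turn the terms in [dot x p'] into the
    corresponding terms at [s x]. *)
Lemma translator_jet_pullback (f : 'rV[R]_n -> R) (x : 'rV[R]_n) : hyp x ->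
  translator_jet f (s x) -> translator_jet (f \o s) x.
Proof.
move=> hx [p [H [jf pl Q0]]].
pose D (i a : 'I_n) := partial i (fun y => s y 0 a).
have dD y (l a : 'I_n) : hyp y -> is_diff y (D l a) (fun v : 'rV[R]_n => dot v (egrad (D l a) y)).
  by move=> hy; exact: (C1_is_diff (@open_hyp R n) hy (Ck1_partial l (sC a 2))).
have Esym l k a : egrad (D l a) x 0 k = egrad (D k a) x 0 l.
  transitivity (partial k (D l a) x); first by rewrite mxE.
  transitivity (partial l (D k a) x); last by rewrite mxE.
  exact (schwarz k l (@open_hyp R n) hx (sC a 2)).
have gram i j y : hyp y -> \sum_a D i a y * D j a y = (i == j)%:R * confsq y.
  move=> hy; have := congr1 (fun M : 'M[R]_n => M i j) (jac_tr hy).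
  rewrite mxE [X in _ = X -> _]mxE mulr_natl => <-.
  by apply: eq_bigr => a _; rewrite !mxE.
have gd i j k := gram_deriv k hx (fun l a => dD x l a hx) (gram i j).
have c0 : confsq x != 0 by rewrite lt0r_neq0 // confsq_gt0.
have JE y : jac y = \matrix_(i, a) D i a y by [].
have TJ := tr_jac hx; have JT := jac_tr hx; rewrite JE in TJ JT.
have dS y : hyp y -> is_diff y s (fun v : 'rV[R]_n => v *m \matrix_(i, a) D i a y).
  exact: is_diff_jac.
have lamE := confsqE hx.
have := jet2_comp (@open_hyp R n) hx dS (fun l a => dD x l a hx) jf.
have cgE : confgrad x = lam x *: x - lam (s x) *: (s x *m (\matrix_(i, a) D i a x)^T) by [].
move: (confgrad x) cgE gd => nu nuE gd.
rewrite (gram_cyclic (D := fun i a => D i a x) c0 Esym gd TJ erefl).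
move: (\matrix_(i, a) D i a x) TJ JT nuE => J TJ JT nuE {gd gram Esym dD dS JE D}.
move: (confsq x) c0 (confsq_gt0 hx) TJ JT lamE => c c0 cpos TJ JT lamE.
set p' := p *m J^T => jf'.
have p'2 : sqnorm p' = c * sqnorm p.
  by rewrite -!dotvv {1}/p' dot_mulmx trmxK -mulmxA TJ mul_mx_scalar dotZr.
have p'J : p' *m J = c *: p by rewrite -mulmxA TJ mul_mx_scalar.
have np : dot nu p' = lam x * dot x p' - lam (s x) * (c * dot (s x) p).
  rewrite nuE dotBl !dotZl; congr (_ - _ * _).
  by rewrite dot_mulmx trmxK p'J dotZr.
clearbody p'.
exists p', (J *m H *m J^T + (nu^T *m p' + p'^T *m nu - (dot nu p')%:M)); split => //.
  by rewrite p'2 lamE ltr_pM2l.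
have tr : \tr (J *m H *m J^T + (nu^T *m p' + p'^T *m nu - (dot nu p')%:M))
   = c * \tr H + (2 - n%:R) * dot nu p'.
  rewrite !mxtraceD -mulmxA mxtrace_mulC -mulmxA TJ mul_mx_scalar mxtraceZ.
  rewrite mxtrace_mulC (mxtrace_mulC p'^T) raddfN /= mxtrace_scalar.
  by rewrite !trace_mx11 !dotE (dotC p') -mulr_natl; ring.
have qd : dot (p' *m (J *m H *m J^T + (nu^T *m p' + p'^T *m nu - (dot nu p')%:M))) p'
   = c ^+ 2 * dot (p *m H) p + dot nu p' * sqnorm p'.
  rewrite !mulmxDr mulmxN !dotDl dotNl !mulmxA p'J mul_mx_scalar.
  rewrite dot_mulmx trmxK p'J -!scalemxAl !dotZl dotZr.
  have e1 (a b d : 'rV[R]_n) : dot (a *m b^T *m d) p' = dot a b * dot d p'.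
    by rewrite [a *m b^T]mx11_scalar dotE mul_scalar_mx dotZl.
  rewrite !e1 dotvv (dotC p' nu); ring.
rewrite /translator_op tr qd p'2 np lamE.
transitivity (c ^+ 2 * translator_op (s x) p H); last by rewrite Q0 mulr0.
rewrite /translator_op; ring.
Qed.
End Pullback.

(** * Hyperbolic boundedness and compactness *)

Section Bounded.
Variables (R : realType) (n : nat).
Implicit Types (c : R -> 'rV[R]_n) (t : R).

Lemma continuous_sqnorm : continuous (@sqnorm R n).
Proof.
move=> x; apply: differentiable_continuous.
by have [] := is_diff_sqnorm x.
Qed.

Lemma tnorm_ghyp (x v : 'rV[R]_n) : tnorm ghyp x v = `|lam x| * Num.sqrt (sqnorm v).
Proof. by rewrite /tnorm inner_ghyp dotvv sqrtrM ?sqr_ge0 // sqrtr_sqr. Qed.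

Lemma is_derive_sqnorm c t : derivable c t 1 ->
  is_derive t (1:R) (fun t => sqnorm (c t)) (2 * dot (c t) (derive1 c t)).
Proof.
move=> dc; have dfc : differentiable c t by exact/derivable1_diffP.
have d := is_diff_comp (differentiableP dfc) (is_diff_sqnorm (c t)).
have dd : differentiable (fun t => sqnorm (c t)) t := @ex_diff _ _ _ _ _ _ _ d.
split; first by apply: diff_derivable; exact: dd.
rewrite (deriveE _ dd) (@diff_val _ _ _ _ _ _ _ d) /= dotZr dotC; congr (_ * dot _ _).
by rewrite derive1E (deriveE _ dfc).
Qed.

(** A substitute for the hyperbolic distance to the origin, from which it differs by at most
    [2 ln 2]; unlike that distance it is smooth at the origin. *)
Definition logdist c t : R := - ln (1 - sqnorm (c t)).

Lemma is_derive_logdist c t : derivable c t 1 -> hyp (c t) ->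
  is_derive t (1:R) (logdist c) (lam (c t) * dot (c t) (derive1 c t)).
Proof.
move=> dc hc.
have d1 := is_derive_sqnorm dc.
have d2 : is_derive t (1:R) (fun t => 1 - sqnorm (c t)) (- (2 * dot (c t) (derive1 c t))).
  have := is_deriveB (is_derive_cst (1 : R) t 1) d1.
  by rewrite sub0r.
have s0 : 0 < 1 - sqnorm (c t) by rewrite subr_gt0.
have d3 := is_deriveN (@is_derive1_comp _ _ (fun t => 1 - sqnorm (c t)) t _ _ (is_derive1_ln s0) d2).
apply: is_derive_eq.
by rewrite /GRing.scale /= /lam mulrN opprK; ring.
Qed.

Lemma speed_bound (x v : 'rV[R]_n) : hyp x ->
  lam x * dot x v <= tnorm ghyp x v.
Proof.
move=> hx; have l0 := lam_gt0 hx.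
rewrite tnorm_ghyp (gtr0_norm l0) ler_pM2l // (le_trans (ler_norm _)) //.
rewrite -sqrtr_sqr ler_wsqrtr // (le_trans (cauchy_schwarz _ _)) //.
by rewrite ler_piMl ?sqnorm_ge0 // ltW.
Qed.

Lemma curve_length_ge0 (G : 'rV[R]_n -> 'M[R]_n) c : 0 <= curve_length G c.
Proof. by apply: Rintegral_ge0 => t _; exact: sqrtr_ge0. Qed.

(** The derivative of [logdist] along the curve is at most the hyperbolic speed, by Cauchy-Schwarz
    and [sqnorm (c t) < 1] ([speed_bound]); integrate. *)
Lemma logdist_le_length c : C1_curve c -> (forall t, 0 <= t <= 1 -> hyp (c t)) ->
  logdist c 1 - logdist c 0 <= curve_length ghyp c.
Proof.
move=> [dc cc'] hc.
have cc : continuous c by move=> t; exact/differentiable_continuous/derivable1_diffP.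
have cl t : 0 <= t <= 1 -> {for t, continuous (fun t => lam (c t))}.
  move=> /hc ht; have [dl _] := is_diff_lam ht.
  exact: (continuous_comp (cc t) (differentiable_continuous dl)).
have csq (d : R -> 'rV[R]_n) t : {for t, continuous d} ->
    {for t, continuous (fun t => sqnorm (d t))}.
  by move=> cd; exact: (continuous_comp cd (@continuous_sqnorm (d t))).
have cN : {within `[0%R, 1%R], continuous (fun t => tnorm ghyp (c t) (derive1 c t))}.
  apply: continuous_in_subspaceT => t; rewrite inE /= in_itv /= => t01.
  under eq_fun do rewrite tnorm_ghyp.
  apply: cvgM.
    exact: (continuous_comp (cl t t01) (@norm_continuous _ _ (lam (c t)))).
  exact: (continuous_comp (csq _ t (cc' t)) (@sqrt_continuous _ (sqnorm (derive1 c t)))).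
have cdot t : {for t, continuous (fun t => dot (c t) (derive1 c t))}.
  have h1 : {for t, continuous (fun t => c t + derive1 c t)}.
    exact: (cvgD (cc t) (cc' t)).
  have h2 : {for t, continuous (fun t =>
      sqnorm (c t + derive1 c t) - sqnorm (c t) - sqnorm (derive1 c t))}.
    exact: (cvgB (cvgB (csq _ t h1) (csq _ t (cc t))) (csq _ t (cc' t))).
  have h3 : {for t, continuous (fun t : R => 2^-1 : R)} by exact: cvg_cst.
  (* Polarisation reduces continuity of the dot product to that of [sqnorm]. *)
  have -> : (fun t => dot (c t) (derive1 c t)) = (fun t =>
     2^-1 * (sqnorm (c t + derive1 c t) - sqnorm (c t) - sqnorm (derive1 c t))).
    apply/funext => s; rewrite -!dotvv !(dotDl, dotDr) (dotC (derive1 c s)).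
    by field.
  exact: (cvgM h3 h2).
have cD : {within `[0%R, 1%R], continuous (fun t => lam (c t) * dot (c t) (derive1 c t))}.
  apply: continuous_in_subspaceT => t; rewrite inE /= in_itv /= => t01.
  apply: cvgM; first exact: cl.
  exact: cdot.
have FTC := continuous_FTC2 (F := logdist c) ltr01 cD.
have dl t : 0 <= t <= 1 -> is_derive t (1:R) (logdist c) (lam (c t) * dot (c t) (derive1 c t)).
  by move=> /hc; exact: is_derive_logdist.
have cld t : 0 <= t <= 1 -> {for t, continuous (logdist c)}.
  by move=> /dl[h _]; exact/differentiable_continuous/derivable1_diffP.
have -> : logdist c 1 - logdist c 0 =
    \int[lebesgue_measure]_(t in `[0%R, 1%R]) (lam (c t) * dot (c t) (derive1 c t)).
  rewrite /Rintegral FTC //.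
    split.
    - by move=> t; rewrite in_itv /= => /andP[t0 t1]; case: (dl t); rewrite ?ltW.
    - by apply: cvg_at_right_filter; apply: cld; rewrite lexx ler01.
    - by apply: cvg_at_left_filter; apply: cld; rewrite lexx ler01.
  move=> t; rewrite in_itv /= => /andP[t0 t1].
  rewrite derive1E; have [|_ //] := dl t.
  by rewrite !ltW.
apply: le_Rintegral => //.
- by apply: continuous_compact_integrable => //; exact: segment_compact.
- by apply: continuous_compact_integrable => //; exact: segment_compact.
by move=> t /=; rewrite in_itv /= => /hc; exact: speed_bound.
Qed.

Lemma segment_hyp (p q : 'rV[R]_n) (r t : R) : sqnorm p <= r -> sqnorm q <= r ->
  0 <= t <= 1 -> sqnorm (p + t *: (q - p)) <= r.
Proof.
move=> hp hq /andP[t0 t1].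
have E : sqnorm (p + t *: (q - p)) =
  (1 - t) * sqnorm p + t * sqnorm q - t * (1 - t) * sqnorm (q - p).
  rewrite -!dotvv !(dotDl, dotDr, dotNl, dotNr, dotZl, dotZr) (dotC q p); ring.
rewrite E; have h : 0 <= t * (1 - t) * sqnorm (q - p).
  by rewrite !mulr_ge0 ?subr_ge0 ?sqnorm_ge0.
have h1 : (1 - t) * sqnorm p <= (1 - t) * r by rewrite ler_wpM2l // subr_ge0.
have h2 : t * sqnorm q <= t * r by rewrite ler_wpM2l.
lra.
Qed.

Lemma riem_dist_logdist (p q : 'rV[R]_n) (r : R) : hyp p -> hyp q ->
  riem_dist ghyp hyp p q <= r ->
  1 - sqnorm q >= (1 - sqnorm p) * expR (- (r + 1)).
Proof.
move=> hp hq; rewrite /riem_dist; set S := mkset _ => Sr.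
(* The infimum is approached by members of [S] only if [S] is nonempty. The Euclidean segment is a
   suitable curve, since the ball is convex. *)
have hS : has_inf S.
  split; last by exists 0 => _ [c [_ _ _ _ ->]]; exact: curve_length_ge0.
  pose c (t : R) := p + t *: (q - p).
  have dc (t : R) : is_diff t c ( *:%R ^~ (q - p)).
    apply: (is_diff_eqf (is_diffD (is_diff_cst p t) (is_diff_scalel t (q - p)))) => // z.
    by rewrite !fctE add0r.
  have dc1 : derive1 c = fun=> q - p.
    apply/funext => t; have d := dc t.
    by rewrite derive1E (deriveE _ (@ex_diff _ _ _ _ _ _ _ d)) (@diff_val _ _ _ _ _ _ _ d) scale1r.
  exists (curve_length ghyp c), c; split => //.
  - split; last by rewrite dc1; exact: cst_continuous.
    by move=> t; apply/derivable1_diffP; have [] := dc t.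
  - by rewrite /c scale0r addr0.
  - by rewrite /c scale1r addrC subrK.
  move=> t t01; apply: (@le_lt_trans _ _ (Num.max (sqnorm p) (sqnorm q))).
    by apply: segment_hyp => //; rewrite le_max lexx ?orbT.
  by rewrite gt_max hp hq.
(* The infimum need not be attained: a curve within 1 of it has length below [r + 1], whence the
   exponent. *)
have [_ [c [C1c c0 c1 hc ->]] lc] := inf_adherent ltr01 hS.
have := logdist_le_length C1c hc; rewrite /logdist c0 c1 opprK => h.
have p0 : 0 < 1 - sqnorm p by rewrite subr_gt0.
have q0 : 0 < 1 - sqnorm q by rewrite subr_gt0.
rewrite -{1}(lnK p0) -(lnK q0) -expRD ler_expR.
by have := ltW (le_lt_trans h lc); lra.
Qed.

(** The distance to a fixed point controls [- ln (1 - sqnorm q)], so a hyperbolically bounded set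
    keeps away from the unit sphere. This is what makes its closure in the ball compact. *)
Lemma riem_bounded_sqnorm (O : set 'rV[R]_n) : O `<=` hyp ->
  riem_bounded ghyp hyp O -> exists2 rho : R, rho < 1 & forall q, O q -> sqnorm q <= rho.
Proof.
move=> Oh [p [r [hp hr]]]; exists (1 - (1 - sqnorm p) * expR (- (r + 1))).
  by rewrite ltrBlDr ltrDl mulr_gt0 ?expR_gt0 // subr_gt0.
move=> q Oq; have := riem_dist_logdist hp (Oh q Oq) (hr q Oq); lra.
Qed.

Lemma closure_sqnorm (O : set 'rV[R]_n) (rho : R) : (forall q, O q -> sqnorm q <= rho) ->
  forall q, closure O q -> sqnorm q <= rho.
Proof.
move=> h q cq; have : closed [set y : 'rV[R]_n | sqnorm y <= rho].
  have -> : [set y : 'rV[R]_n | sqnorm y <= rho] = (@sqnorm R n) @^-1` [set s : R | s <= rho] by [].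
  by apply: preimage_closed; [move=> x _; exact: continuous_sqnorm|exact: closed_le].
by move=> /closure_id E; have := closureS h cq; rewrite -E.
Qed.

Lemma compact_hclosure (O : set 'rV[R]_n) (rho : R) : rho < 1 ->
  (forall q, O q -> sqnorm q <= rho) -> compact (hclosure O).
Proof.
move=> r1 h; have cl := closure_sqnorm h.
have -> : hclosure O = closure O.
  by apply/seteqP; split => [q []//|q cq]; split => //; exact: le_lt_trans (cl q cq) r1.
apply: bounded_closed_compact; last exact: closed_closure.
exists 1; split => // M M1 q /cl hq; apply: le_trans (ltW M1).
rewrite -[leRHS]ger0_norm // -ler_sqr ?nnegrE // [leRHS]expr2 normr1 mulr1.
by rewrite (le_trans (norm_sqr_le_sqnorm q)) // (le_trans hq) // ltW.
Qed.
End Bounded.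

(** * Uniform Lipschitz bounds for isometries *)

(** The first-order content of being an isometry, stable under composition and sufficient for
    Lipschitz estimates; iterates then need no smoothness proof. *)
Definition loc_isom (R : realType) (n : nat) (f : 'rV[R]_n -> 'rV[R]_n) : Prop :=
  forall x, hyp x -> hyp (f x) /\ exists2 J : 'M[R]_n,
    is_diff x f (fun v : 'rV[R]_n => v *m J) &
    forall v, lam (f x) ^+ 2 * sqnorm (v *m J) = lam x ^+ 2 * sqnorm v.

Section Isom.
Variables (R : realType) (n : nat).
Implicit Types (f g s : 'rV[R]_n -> 'rV[R]_n).

Lemma loc_isom_id : loc_isom (id : 'rV[R]_n -> 'rV[R]_n).
Proof.
move=> x hx; split => //; exists 1%:M => [|v]; last by rewrite mulmx1.
by apply: (is_diff_eqf (is_diff_id x)) => // v; rewrite mulmx1.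
Qed.

Lemma loc_isom_comp f g : loc_isom f -> loc_isom g -> loc_isom (g \o f).
Proof.
move=> If Ig x hx; have [hfx [J dJ eJ]] := If x hx.
have [hgx [K dK eK]] := Ig _ hfx; split => //; exists (J *m K) => [|v].
  by apply: (is_diff_eqf (is_diff_comp dJ dK)) => // v; rewrite /= mulmxA.
by rewrite mulmxA eK eJ.
Qed.

Lemma loc_isom_iter f k : loc_isom f -> loc_isom (iter k f).
Proof.
move=> If; elim: k => [|k IH]; first exact: loc_isom_id.
exact: (loc_isom_comp IH If).
Qed.

Lemma riem_isometry_loc s : riem_isometry ghyp hyp s -> loc_isom s.
Proof.
move=> [ss sh _ si] x hx; split; first exact: sh.
exists (jac s x) => [|v]; first exact: is_diff_jac.
by have := si x v v hx; rewrite !inner_ghyp !derive_jac // !dotvv.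
Qed.

(** The differential of [s \o s'] is the identity, so the isometry identity of [s] at [s' x] is that
    of [s'] at [x]. The inverse serves for the lower Lipschitz bound on iterates. *)
Lemma riem_isometry_inv s : riem_isometry ghyp hyp s ->
  exists s', loc_isom s' /\ forall x, hyp x -> s' (s x) = x /\ s (s' x) = x.
Proof.
move=> Is; have [ss sh [s' [ss' sh' s's ss's]] si] := Is.
exists s'; split; last by move=> x hx; rewrite s's // ss's.
move=> x hx; split; first exact: sh'.
have hs'x := sh' x hx; exists (jac s' x) => [|v]; first exact: is_diff_jac.
have d1 := is_diff_comp (is_diff_jac ss' hx) (is_diff_jac ss hs'x).
have E : 'D_v (s \o s') x = 'D_v id x.
  apply: near_eq_derive; have nU : \forall y \near x, hyp y.
    by apply: open_nbhs_nbhs; split => //; exact: open_hyp.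
  by apply: (@filterS _ (nbhs x) (nbhs_filter x) _ _ _ nU) => y; exact: ss's.
move: E; rewrite derive_id (deriveE _ (@ex_diff _ _ _ _ _ _ _ d1)).
rewrite (@diff_val _ _ _ _ _ _ _ d1) /= => E.
have := si (s' x) (v *m jac s' x) (v *m jac s' x) hs'x.
by rewrite !inner_ghyp !derive_jac // E ss's // !dotvv => ->.
Qed.

(** Mean value theorem on the segment, coordinate by coordinate. There [lam <= 2 / (1 - rho)], while
    [lam >= 2] at the image, so the differential expands Euclidean length by at most
    [1 / (1 - rho)]. Passing to the sup norm costs the square root of [n], majorised by [n.+1]. The
    constant does not depend on [f], hence serves all iterates and their inverses. *)
Lemma loc_isom_lipschitz f (rho : R) : rho < 1 -> loc_isom f ->
  forall x y, sqnorm x <= rho -> sqnorm y <= rho ->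
  `|f x - f y| <= n.+1%:R / (1 - rho) * `|x - y|.
Proof.
move=> r1 If x y hx hy; have r0 : 0 < 1 - rho by rewrite subr_gt0.
have L0 : 0 <= n.+1%:R / (1 - rho) * `|x - y| by rewrite mulr_ge0 // divr_ge0 // ltW.
apply: norm_le_coord => // a.
have hseg (t : R) : 0 <= t <= 1 -> sqnorm (y + t *: (x - y)) <= rho.
  exact: segment_hyp.
have hs (t : R) : 0 <= t <= 1 -> hyp (y + t *: (x - y)).
  by move=> /hseg h; exact: le_lt_trans h r1.
have df (t : R) : 0 <= t <= 1 -> derivable (fun z => f z 0 a) (y + t *: (x - y)) (x - y).
  move=> /hs h; have [_ [J dJ _]] := If _ h.
  apply: diff_derivable; have [d _] := is_diff_component a dJ; exact: d.
have [t t01 E] := mvt_dir df.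
have t01' : 0 <= t <= 1 by case/andP: t01 => /ltW-> /ltW->.
have h := hs t t01'; have [hf [J dJ eJ]] := If _ h.
move: E; rewrite [y + (x - y)]addrC subrK; have d := is_diff_component a dJ.
rewrite (deriveE _ (@ex_diff _ _ _ _ _ _ _ d)) (@diff_val _ _ _ _ _ _ _ d) => E.
rewrite !mxE E -ler_sqr ?nnegrE // real_normK ?num_real //.
apply: le_trans (coord_le_sqnorm _ _) _.
set z := y + _ in h hf eJ.
have lz : lam z <= 2 / (1 - rho).
  by rewrite /lam ler_pM2l // lef_pV2 ?posrE ?subr_gt0 // lerB // hseg.
have l2 := lam_ge2 hf; have lz0 := lam_gt0 h.
have e1 : 4 * sqnorm ((x - y) *m J) <= (2 / (1 - rho)) ^+ 2 * sqnorm (x - y).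
  apply: (@le_trans _ _ (lam z ^+ 2 * sqnorm (x - y))); last first.
    have q0 : 0 <= 2 / (1 - rho) by rewrite divr_ge0 // ltW.
    by rewrite ler_wpM2r ?sqnorm_ge0 // ler_sqr ?nnegrE // ltW.
  rewrite -eJ ler_wpM2r ?sqnorm_ge0 //.
  have -> : 4 = 2 ^+ 2 :> R by ring.
  by rewrite ler_sqr ?nnegrE ?(le_trans _ l2).
have e2 := sqnorm_le_norm (x - y).
have e3 : sqnorm ((x - y) *m J) <= (1 - rho) ^- 2 * sqnorm (x - y).
  have : 4 * sqnorm ((x - y) *m J) <= 4 * ((1 - rho) ^- 2 * sqnorm (x - y)).
    apply: le_trans e1 _; rewrite exprMn exprVn -mulrA; have -> : 2 ^+ 2 = 4 :> R by ring.
    exact: lexx.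
  by rewrite ler_pM2l.
apply: le_trans e3 _; rewrite !exprMn exprVn -mulrA mulrCA.
rewrite ler_pM2l ?invr_gt0 ?exprn_gt0 //; apply: le_trans e2 _.
rewrite ler_wpM2r ?sqr_ge0 //; rewrite -natrX ler_nat.
by rewrite (leq_trans (leqnSn n)) // -{1}(muln1 n.+1) leq_mul2l /=.
Qed.
End Isom.

(** * The barrier *)

Section Perturb.
Variables (R : realType) (n : nat).
Implicit Types (x p G P : 'rV[R]_n) (H D : 'M[R]_n) (e : R).

(** The difference quotient of [translator_op] when [p] and [H] move by [- e *: G] and [- e *: D],
    written in scalar invariants. Being a polynomial, it makes sense at [e = 0] and is continuous
    there. *)
Definition slope_poly (e l N t d a g b xp xg h1 h2 h3 : R) : R :=
  (2 * b - e * g) * (t + (N - 2) * l * xp - l * l)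
  - (l * l - a) * (d + (N - 2) * l * xg)
  - e * (2 * b - e * g) * (d + (N - 2) * l * xg)
  - (h1 - e * h2 + e * e * h3)
  + l * (xg * a + xp * (2 * b - e * g) - e * xg * (2 * b - e * g)).

Definition op_slope x p H G D e : R :=
  slope_poly e (lam x) n%:R (\tr H) (\tr D) (sqnorm p) (sqnorm G) (dot p G)
    (dot x p) (dot x G)
    (dot (p *m H) G + dot (G *m H) p + dot (p *m D) p)
    (dot (G *m H) G + dot (p *m D) G + dot (G *m D) p)
    (dot (G *m D) G).

Lemma translator_op_slope x p H G D e :
  translator_op x (p - e *: G) (H - e *: D) =
  translator_op x p H + e * op_slope x p H G D e.
Proof.
rewrite /translator_op /op_slope /slope_poly mxtraceD raddfN /= mxtraceZ.
have -> : sqnorm (p - e *: G) = sqnorm p - e * (2 * dot p G - e * sqnorm G).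
  by rewrite -!dotvv !(dotBl, dotBr, dotZl, dotZr) (dotC G p); ring.
have -> : dot x (p - e *: G) = dot x p - e * dot x G by rewrite dotBr dotZr.
have -> : dot ((p - e *: G) *m (H - e *: D)) (p - e *: G) =
   dot (p *m H) p - e * (dot (p *m H) G + dot (G *m H) p + dot (p *m D) p
    - e * (dot (G *m H) G + dot (p *m D) G + dot (G *m D) p)
    + e ^+ 2 * dot (G *m D) G).
  rewrite mulmxBl !mulmxBr -!scalemxAl -!scalemxAr !(dotBl, dotBr, dotZl, dotZr).
  ring.
ring.
Qed.

(** Ellipticity: [H] enters through its trace, with coefficient [lam x ^+ 2 - sqnorm P > 0], and
    through its quadratic form on [P]. *)
Lemma translator_op_le x P H1 H2 : sqnorm P < lam x ^+ 2 ->
  (forall w : 'rV[R]_n, dot (w *m (H1 - H2)) w <= 0) ->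
  translator_op x P H1 <= translator_op x P H2.
Proof.
move=> W h; rewrite /translator_op lerD2r lerD //.
  rewrite ler_pM2l ?subr_gt0 // lerD2r lerD2r -subr_le0 -raddfB /=.
  apply: sumr_le0 => i _; have := h (delta_mx 0 i).
  by rewrite -rowE dot_delta mxE.
by have := h P; rewrite mulmxBr dotBl subr_le0.
Qed.

(** [G] and [D] are here the gradient and Hessian of the barrier at its centre. The equation
    eliminates the trace term multiplied by [lam x ^+ 2 - sqnorm p]. The coefficient of [al ^+ 2] is
    negative unless [p = 0], and then the coefficient of [al] is [- lam x ^+ 4]. *)
Lemma op_slope_at x p H (al : R) : translator_op x p H = 0 ->
  op_slope x p H (al *: p) (al *: H + al ^+ 2 *: (p^T *m p) - 2%:M) 0 =
  al * (2 * sqnorm p * (\tr H + (n%:R - 2) * lam x * dot x p - lam x ^+ 2)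
        - 2 * dot (p *m H) p + 2 * lam x * dot x p * sqnorm p
        - lam x ^+ 2 * (lam x ^+ 2 - sqnorm p))
  - al ^+ 2 * (sqnorm p * lam x ^+ 2)
  + (2 * n%:R * (lam x ^+ 2 - sqnorm p) + 2 * sqnorm p).
Proof.
move=> Q0; rewrite /op_slope /slope_poly.
have -> : \tr (al *: H + al ^+ 2 *: (p^T *m p) - 2%:M) =
    al * \tr H + al ^+ 2 * sqnorm p - 2 * n%:R.
  rewrite !mxtraceD raddfN /= mxtrace_scalar !mxtraceZ mxtrace_mulC trace_mx11.
  by rewrite dotE dotvv mulr_natr.
have -> : dot (p *m (al *: H + al ^+ 2 *: (p^T *m p) - 2%:M)) p =
    al * dot (p *m H) p + al ^+ 2 * sqnorm p ^+ 2 - 2 * sqnorm p.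
  rewrite mulmxBr mulmxDr -!scalemxAr mul_mx_scalar mulmxA dotBl dotDl !dotZl !dotvv.
  by rewrite [p *m p^T]mx11_scalar dotE mul_scalar_mx dotZl dotvv expr2.
rewrite -!scalemxAl !(dotZr, dotZl) !dotvv.
have E : (lam x ^+ 2 - sqnorm p) * (\tr H + (n%:R - 2) * lam x * dot x p - lam x ^+ 2)
  = lam x * dot x p * sqnorm p - dot (p *m H) p.
  transitivity (translator_op x p H + lam x * dot x p * sqnorm p - dot (p *m H) p).
    rewrite /translator_op; ring.
  by rewrite Q0 add0r.
transitivity (al * (2 * sqnorm p * (\tr H + (n%:R - 2) * lam x * dot x p - lam x ^+ 2)
    - 3 * dot (p *m H) p + 3 * lam x * dot x p * sqnorm p
    - lam x ^+ 2 * (lam x ^+ 2 - sqnorm p)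
    - (lam x ^+ 2 - sqnorm p) * (\tr H + (n%:R - 2) * lam x * dot x p - lam x ^+ 2))
  - al ^+ 2 * (sqnorm p * lam x ^+ 2)
  + (2 * n%:R * (lam x ^+ 2 - sqnorm p) + 2 * sqnorm p)).
  ring.
rewrite E; ring.
Qed.

Lemma exists_large_slope (a c1 c2 l : R) : 0 <= a -> 0 < l ->
  (a = 0 -> c1 < 0) ->
  exists2 al : R, 0 < al & al * c1 - al ^+ 2 * (a * l) + c2 < 0.
Proof.
move=> a0 l0 h; have [az|an] := eqVneq a 0.
  have c1n := h az; exists ((`|c2| + 1) / - c1).
    by rewrite divr_gt0 ?oppr_gt0 // ltr_wpDl.
  rewrite az mul0r mulr0 subr0 invrN mulrN mulNr divfK ?lt_eqF //.
  by have := ler_norm c2; lra.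
have al0 : 0 < a * l by rewrite mulr_gt0 // lt_neqAle eq_sym an.
have [c10 c20] := (normr_ge0 c1, normr_ge0 c2).
(* [al * (a * l)] exceeds [|c1| + |c2| + 1], so the quadratic term beats the linear one, and the
   excess, multiplied by [al >= 1], beats [c2]. *)
pose al := (`|c1| + `|c2| + 1) / (a * l) + 1.
have al1 : 1 <= al by rewrite lerDr divr_ge0 ?(ltW al0) // !addr_ge0.
exists al; first exact: lt_le_trans al1.
have E : al * (a * l) = `|c1| + `|c2| + 1 + a * l.
  by rewrite /al mulrDl divfK ?mul1r // lt0r_neq0.
have h1 : al * c1 <= al * `|c1| by rewrite ler_wpM2l ?ler_norm // (le_trans _ al1).
have h2 : `|c2| + 1 + a * l <= al * (`|c2| + 1 + a * l).
  by rewrite ler_peMl // !addr_ge0 // ltW.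
have h3 := ler_norm c2.
rewrite expr2 -mulrA E.
have -> : al * (`|c1| + `|c2| + 1 + a * l) = al * `|c1| + al * (`|c2| + 1 + a * l) by ring.
lra.
Qed.

Lemma cvg_bigsum (T : Type) (F : set_system T) (FF : Filter F) (I : Type) (r : seq I)
    (f : I -> T -> R) (l : I -> R) : (forall i, f i @ F --> l i) ->
  (fun z => \sum_(i <- r) f i z) @ F --> \sum_(i <- r) l i.
Proof.
move=> h; elim: r => [|i r IH].
  under eq_fun do rewrite big_nil; rewrite big_nil; exact: cvg_cst.
under eq_fun do rewrite big_cons; rewrite big_cons; exact: cvgD.
Qed.

Lemma cvg_dot (T : Type) (F : set_system T) (FF : Filter F)
    (f g : T -> 'rV[R]_n) (a b : 'rV[R]_n) :
  (forall i, (fun z => f z 0 i) @ F --> a 0 i) ->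
  (forall i, (fun z => g z 0 i) @ F --> b 0 i) ->
  (fun z => dot (f z) (g z)) @ F --> dot a b.
Proof. by move=> hf hg; apply: cvg_bigsum => i; exact: cvgM. Qed.

Lemma cvg_mulmx_row (T : Type) (F : set_system T) (FF : Filter F)
    (f : T -> 'rV[R]_n) (H : T -> 'M[R]_n) (a : 'rV[R]_n) (K : 'M[R]_n) :
  (forall i, (fun z => f z 0 i) @ F --> a 0 i) ->
  (forall i j, (fun z => H z i j) @ F --> K i j) ->
  forall j, (fun z => (f z *m H z) 0 j) @ F --> (a *m K) 0 j.
Proof.
move=> hf hH j; under eq_fun do rewrite mxE; rewrite mxE.
by apply: cvg_bigsum => i; exact: cvgM.
Qed.

Lemma cvg_mxtrace (T : Type) (F : set_system T) (FF : Filter F)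
    (H : T -> 'M[R]_n) (K : 'M[R]_n) : (forall i j, (fun z => H z i j) @ F --> K i j) ->
  (fun z => \tr (H z)) @ F --> \tr K.
Proof. by move=> hH; apply: cvg_bigsum => i. Qed.

Lemma cvg_sqnorm (T : Type) (F : set_system T) (FF : Filter F)
    (f : T -> 'rV[R]_n) (a : 'rV[R]_n) : (forall i, (fun z => f z 0 i) @ F --> a 0 i) ->
  (fun z => sqnorm (f z)) @ F --> sqnorm a.
Proof.
by move=> hf; rewrite -dotvv; under eq_fun do rewrite -dotvv; exact: cvg_dot.
Qed.

Lemma cvg_slope_poly (T : Type) (F : set_system T) (FF : Filter F)
    (fe fl ft fd fa fg fb fxp fxg f1 f2 f3 : T -> R)
    (e l N t d a g b xp xg h1 h2 h3 : R) :
  fe @ F --> e -> fl @ F --> l -> ft @ F --> t -> fd @ F --> d -> fa @ F --> a ->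
  fg @ F --> g -> fb @ F --> b -> fxp @ F --> xp -> fxg @ F --> xg ->
  f1 @ F --> h1 -> f2 @ F --> h2 -> f3 @ F --> h3 ->
  (fun z => slope_poly (fe z) (fl z) N (ft z) (fd z) (fa z) (fg z) (fb z)
     (fxp z) (fxg z) (f1 z) (f2 z) (f3 z)) @ F -->
  slope_poly e l N t d a g b xp xg h1 h2 h3.
Proof.
move=> he hl ht hd ha hg hb hxp hxg hh1 hh2 hh3.
have c2 : (fun=> 2 : R) @ F --> (2 : R) by exact: cvg_cst.
have cN : (fun=> N - 2 : R) @ F --> (N - 2 : R) by exact: cvg_cst.
have cD (f f' : T -> R) (y y' : R) : f @ F --> y -> f' @ F --> y' ->
  (fun z => f z + f' z) @ F --> y + y' by move=> *; exact: cvgD.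
have cB (f f' : T -> R) (y y' : R) : f @ F --> y -> f' @ F --> y' ->
  (fun z => f z - f' z) @ F --> y - y' by move=> *; exact: cvgB.
have cM (f f' : T -> R) (y y' : R) : f @ F --> y -> f' @ F --> y' ->
  (fun z => f z * f' z) @ F --> y * y' by move=> *; exact: cvgM.
have hA := cB _ _ _ _ (cM _ _ _ _ c2 hb) (cM _ _ _ _ he hg).
have hl2 := cM _ _ _ _ hl hl.
have hY := cB _ _ _ _ (cD _ _ _ _ ht (cM _ _ _ _ (cM _ _ _ _ cN hl) hxp)) hl2.
have hy := cD _ _ _ _ hd (cM _ _ _ _ (cM _ _ _ _ cN hl) hxg).
have hq := cD _ _ _ _ (cB _ _ _ _ hh1 (cM _ _ _ _ he hh2)) (cM _ _ _ _ (cM _ _ _ _ he he) hh3).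
have hz := cM _ _ _ _ hl (cB _ _ _ _ (cD _ _ _ _ (cM _ _ _ _ hxg ha)
  (cM _ _ _ _ hxp hA)) (cM _ _ _ _ (cM _ _ _ _ he hxg) hA)).
exact: cD _ _ _ _ (cB _ _ _ _ (cB _ _ _ _ (cB _ _ _ _ (cM _ _ _ _ hA hY)
  (cM _ _ _ _ (cB _ _ _ _ hl2 ha) hy)) (cM _ _ _ _ (cM _ _ _ _ he hA) hy)) hq) hz.
Qed.

Lemma cvg_op_slope (T : Type) (F : set_system T) (FF : Filter F)
    (x p G : T -> 'rV[R]_n) (H D : T -> 'M[R]_n) (e : T -> R)
    (x0 p0 G0 : 'rV[R]_n) (H0 D0 : 'M[R]_n) (e0 : R) :
  (forall i, (fun z => x z 0 i) @ F --> x0 0 i) ->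
  (forall i, (fun z => p z 0 i) @ F --> p0 0 i) ->
  (forall i, (fun z => G z 0 i) @ F --> G0 0 i) ->
  (forall i j, (fun z => H z i j) @ F --> H0 i j) ->
  (forall i j, (fun z => D z i j) @ F --> D0 i j) ->
  e @ F --> e0 -> (fun z => lam (x z)) @ F --> lam x0 ->
  (fun z => op_slope (x z) (p z) (H z) (G z) (D z) (e z)) @ F -->
  op_slope x0 p0 H0 G0 D0 e0.
Proof.
move=> hx hp hG hH hD he hl; apply: cvg_slope_poly => //.
- exact: cvg_mxtrace.
- exact: cvg_mxtrace.
- exact: cvg_sqnorm.
- exact: cvg_sqnorm.
- exact: cvg_dot.
- exact: cvg_dot.
- exact: cvg_dot.
- by apply: cvgD; [apply: cvgD|]; apply: cvg_dot => //; exact: cvg_mulmx_row.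
- by apply: cvgD; [apply: cvgD|]; apply: cvg_dot => //; exact: cvg_mulmx_row.
- by apply: cvg_dot => //; exact: cvg_mulmx_row.
Qed.
End Perturb.

(** With [s = al * (u x - u x0)], the part [s + s ^+ 2 / 2] is [exp s - 1] truncated at order two:
    its convexity yields the [al ^+ 2] term of the Hessian, and it is nonpositive exactly for [s] in
    [-2, 0]. *)
Definition barrier (R : realType) (n : nat) (u : 'rV[R]_n -> R) (x0 : 'rV[R]_n)
    (al : R) (x : 'rV[R]_n) : R :=
  al * (u x - u x0) + (al * (u x - u x0)) ^+ 2 / 2 - sqnorm (x - x0).

Section Barrier.
Variables (R : realType) (n : nat) (O : set 'rV[R]_n) (u : 'rV[R]_n -> R) (x0 : 'rV[R]_n).
Hypotheses (oO : open O) (Oh : O `<=` hyp) (u2 : Ck 2 O u) (Ox0 : O x0).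
Hypothesis u_sol : forall x, O x ->
  sqnorm (egrad u x) < lam x ^+ 2 /\ translator_op x (egrad u x) (ehess u x) = 0.

Let t (al : R) x := al * (u x - u x0).
Let G al x : 'rV[R]_n := (al * (1 + t al x)) *: egrad u x - 2 *: (x - x0).
Let D al x : 'M[R]_n := (al * (1 + t al x)) *: ehess u x
  + al ^+ 2 *: ((egrad u x)^T *m egrad u x) - 2%:M.

Lemma jet2_barrier al x : O x -> jet2 (barrier u x0 al) x (G al x) (D al x).
Proof.
move=> Ox; have ju := jet2_Ck oO Ox u2.
have jt := jet2Z al (jet2D ju (jet2_cst (- u x0) x)).
have := jet2D (jet2D jt (jet2Z 2^-1 (jet2_sqr jt))) (jet2Z (-1) (jet2_sqdist x0 x)).
rewrite !addr0; set p := egrad u x; set H := ehess u x.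
have -> : (fun y => al * (u y + - u x0) + 2^-1 * (al * (u y + - u x0)) ^+ 2 + -1 * sqnorm (y - x0))
   = barrier u x0 al.
  by apply/funext => y; rewrite /barrier mulN1r (mulrC 2^-1).
have -> : al *: p + 2^-1 *: ((2 * (al * (u x + - u x0))) *: (al *: p)) + -1 *: (2 *: (x - x0))
   = G al x.
  rewrite /G /t !scalerA -scalerDl mulN1r scaleNr; by congr (_ *: _ - _); field.
have -> : al *: H + 2^-1 *: ((2 * (al * (u x + - u x0))) *: (al *: H)
     + 2 *: ((al *: p)^T *m (al *: p))) + -1 *: 2%:M = D al x.
  rewrite /D /t scaleN1r scalerDr addrA !scalerA -scalerDl.
  rewrite [(al *: p)^T]linearZ /= -scalemxAl -scalemxAr !scalerA.
  by congr (_ *: _ + _ *: _ - _); field.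
by [].
Qed.

Lemma u_continuous x : O x -> {for x, continuous u}.
Proof. by move=> Ox; exact: u2.1. Qed.

(** Negativity is arranged at the centre with [e = 0] by the choice of [al], then spreads by
    continuity jointly in [x] and [e]. *)
Lemma slope_neg : exists2 al : R, 0 < al &
  \forall z \near ((x0, 0) : 'rV[R]_n * R),
    op_slope z.1 (egrad u z.1) (ehess u z.1) (G al z.1) (D al z.1) z.2 < 0.
Proof.
have [s0 Q0] := u_sol Ox0; have l0 := lam_gt0 (Oh Ox0).
set p := egrad u x0 in s0 Q0; set H := ehess u x0 in Q0.
have l20 : 0 < lam x0 ^+ 2 by rewrite exprn_gt0.
have [|al al0 hal] := @exists_large_slope R (sqnorm p)
  (2 * sqnorm p * (\tr H + (n%:R - 2) * lam x0 * dot x0 p - lam x0 ^+ 2)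
        - 2 * dot (p *m H) p + 2 * lam x0 * dot x0 p * sqnorm p
        - lam x0 ^+ 2 * (lam x0 ^+ 2 - sqnorm p))
  (2 * n%:R * (lam x0 ^+ 2 - sqnorm p) + 2 * sqnorm p) (lam x0 ^+ 2) (sqnorm_ge0 p) l20.
  move=> /eqP; rewrite sqnorm_eq0 => /eqP ->.
  rewrite mul0mx !dot0l dot0r -dotvv dot0l !(mulr0, mul0r) !subr0 !add0r.
  by rewrite oppr_lt0 mulr_gt0.
exists al => //.
have t0 : t al x0 = 0 by rewrite /t subrr mulr0.
have G0 : G al x0 = al *: p by rewrite /G t0 addr0 mulr1 subrr scaler0 subr0.
have D0 : D al x0 = al *: H + al ^+ 2 *: (p^T *m p) - 2%:M by rewrite /D t0 addr0 mulr1.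
have neg : op_slope x0 p H (G al x0) (D al x0) 0 < 0 by rewrite G0 D0 op_slope_at.
pose F := nbhs ((x0, 0) : 'rV[R]_n * R).
have lift (f : 'rV[R]_n -> R) : {for x0, continuous f} -> (fun z => f z.1) @ F --> f x0.
  move=> cf; have h : {for (x0, 0 : R), continuous (fst : 'rV[R]_n * R -> 'rV[R]_n)} by exact: cvg_fst.
  exact: (continuous_comp h cf).
have c1 i : {for x0, continuous (fun x : 'rV[R]_n => x 0 i : R)} by exact: coord_continuous.
have cu := u_continuous Ox0.
have cp i : {for x0, continuous (fun x => egrad u x 0 i)}.
  have -> : (fun x => egrad u x 0 i) = partial i u by apply/funext => x; rewrite mxE.
  exact: (u2.2 i).2.1.
have cH i j : {for x0, continuous (fun x => ehess u x i j)}.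
  have -> : (fun x => ehess u x i j) = partial i (partial j u) by apply/funext => x; rewrite mxE.
  exact: ((u2.2 j).2.2 i).2.1.
have cl : {for x0, continuous (@lam R n)}.
  by apply: differentiable_continuous; have [] := is_diff_lam (Oh Ox0).
have cM (f g : 'rV[R]_n -> R) : {for x0, continuous f} -> {for x0, continuous g} ->
  {for x0, continuous (fun x => f x * g x)} 
    by move=> hf hg; exact: (@cvgM _ _ (nbhs x0) (nbhs_filter x0) f g _ _ hf hg).
have cA (f g : 'rV[R]_n -> R) : {for x0, continuous f} -> {for x0, continuous g} ->
  {for x0, continuous (fun x => f x + g x)} 
    by move=> hf hg; exact: (@cvgD _ _ _ (nbhs x0) (nbhs_filter x0) f g _ _ hf hg).
have cC (c : R) : {for x0, continuous (fun _ : 'rV[R]_n => c)}.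
  exact: cst_continuous.
have ct : {for x0, continuous (t al)} := cM _ _ (cC al) (cA _ _ cu (cC (- u x0))).
have cat := cM _ _ (cC al) (cA _ _ (cC 1) ct).
have cG i : {for x0, continuous (fun x => G al x 0 i)}.
  have -> : (fun x => G al x 0 i) =
      (fun x => al * (1 + t al x) * egrad u x 0 i + - 2 * (x 0 i + - x0 0 i)).
    by apply/funext => x; rewrite /G !mxE mulNr.
  exact: cA _ _ (cM _ _ cat (cp i)) (cM _ _ (cC (- 2)) (cA _ _ (c1 i) (cC (- x0 0 i)))).
have cD i j : {for x0, continuous (fun x => D al x i j)}.
  have -> : (fun x => D al x i j) = (fun x => al * (1 + t al x) * ehess u x i j
      + al ^+ 2 * (egrad u x 0 i * egrad u x 0 j) + - (2%:M : 'M[R]_n) i j).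
    by apply/funext => x; rewrite /D !mxE big_ord1 !mxE.
  exact: cA _ _ (cA _ _ (cM _ _ cat (cH i j)) (cM _ _ (cC (al ^+ 2)) (cM _ _ (cp i) (cp j))))
    (cC (- (2%:M : 'M[R]_n) i j)).
have c2 : snd @ F --> (0 : R) by exact: cvg_snd.
have FF : Filter F by exact: nbhs_filter.
have cs := @cvg_op_slope R n _ F FF fst (egrad u \o fst) (G al \o fst)
   (ehess u \o fst) (D al \o fst) snd x0 p (G al x0) H (D al x0) 0
   (fun i => lift _ (c1 i)) (fun i => lift _ (cp i)) (fun i => lift _ (cG i))
   (fun i j => lift _ (cH i j)) (fun i j => lift _ (cD i j)) c2 (lift _ cl).
exact: (@cvgr_lt _ _ F FF _ _ cs _ neg).
Qed.

(** At such a maximum the gradient of [v] is that of [u - e h] and its Hessian lies below that of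
    [u - e h], where [h] is the barrier. By ellipticity the operator of [u - e h] is nonnegative
    there, yet it equals [e] times a negative slope. *)
Lemma barrier_no_max : exists al rho e0 : R, [/\ 0 < rho, 0 < e0,
  (forall x, `|x - x0| <= rho -> O x),
  (forall x, `|x - x0| <= rho -> u x <= u x0 -> barrier u x0 al x <= - sqnorm (x - x0)) &
  forall x e v, `|x - x0| <= rho -> 0 < e -> e <= e0 -> translator_jet v x ->
    ~ (\forall y \near x, v y - u y + e * barrier u x0 al y
         <= v x - u x + e * barrier u x0 al x)].
Proof.
have [al al0 /nbhs_ballP[d d0 hd]] := slope_neg.
have [d1 d10 hd1] : exists2 d : R, 0 < d & forall y, `|y - x0| < d -> O y.
  by apply/near_distP; exact: open_nbhs_nbhs.
(* Within [2 / al] of [u x0] the quantity [s = al * (u x - u x0)] is at least -2, so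
   [s * (s + 2) / 2 <= 0] whenever [u x <= u x0]. *)
have a2 : 0 < 2 / al by rewrite divr_gt0.
have /cvgrPdist_le/(_ _ a2)/near_distP[d2 d20 hd2] := u_continuous Ox0.
pose m := Num.min d (Num.min d1 d2).
have m0 : 0 < m by rewrite !lt_min d0 d10.
have lem x : `|x - x0| <= m / 2 -> [/\ `|x - x0| < d, `|x - x0| < d1 & `|x - x0| < d2].
  move=> h; have : `|x - x0| < m by apply: le_lt_trans h _; lra.
  by rewrite !lt_min => /andP[-> /andP[-> ->]].
exists al, (m / 2), (d / 2); split.
- by rewrite divr_gt0.
- by rewrite divr_gt0.
- by move=> x /lem[_ /hd1].
- move=> x /lem[_ _ /hd2 h] ux; rewrite /barrier gerDr ?ler_pwDl //.
  have s0 : al * (u x - u x0) <= 0 by rewrite mulr_ge0_le0 ?(ltW al0) // subr_le0.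
  have s2 : -2 <= al * (u x - u x0).
    move: h; rewrite ler_distlC => /andP[h _].
    have : - (2 / al) <= u x - u x0 by lra.
    rewrite -(ler_pM2l al0) mulrN mulrC divfK // lt0r_neq0 //.
  set s := al * _ in s0 s2 *.
  have -> : s + s ^+ 2 / 2 = s * (s + 2) / 2 by field.
  have : s * (s + 2) <= 0 by rewrite mulr_le0_ge0 //; lra.
  lra.
move=> x e v /lem[xd xd1 _] e0 ed [P [Hv [jv PW Q0]]] mx.
have Ox := hd1 x xd1; have [_ Qu] := u_sol Ox.
have j := jet2D (jet2D jv (jet2Z (-1) (jet2_Ck oO Ox u2))) (jet2Z e (jet2_barrier al Ox)).
have [|Peq Hle] := jet2_max j.
  by apply: (@filterS _ (nbhs x) (nbhs_filter x) _ _ _ mx) => y; rewrite !mulN1r.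
have PE : P = egrad u x - e *: G al x.
  by apply/eqP; rewrite -subr_eq0 -Peq scaleN1r opprB addrA addrAC.
have := @translator_op_le R n x P Hv (ehess u x - e *: D al x) PW.
rewrite Q0 PE translator_op_slope Qu add0r pmulr_rge0 //.
have neg : op_slope x (egrad u x) (ehess u x) (G al x) (D al x) e < 0.
  apply: (hd (x, e)); split => /=.
    by rewrite mx_norm_ball /ball_ /= distrC.
  by rewrite /ball /= sub0r normrN gtr0_norm //; lra.
move=> h; have hw w : dot (w *m (Hv - (ehess u x - e *: D al x))) w <= 0.
  by have := Hle w; rewrite scaleN1r opprB addrA addrAC.
by have := h hw; rewrite leNgt neg.
Qed.
End Barrier.

(** * Orbits *)

Definition orbit_limit (R : realType) (n : nat) (f : 'rV[R]_n -> 'rV[R]_n) (p q : 'rV[R]_n) :=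
  forall e : R, 0 < e -> exists k, `|iter k f p - q| < e.

Section Orbits.
Variables (R : realType) (n : nat) (K : set 'rV[R]_n) (f : 'rV[R]_n -> 'rV[R]_n) (L : R).
Hypotheses (cK : compact K) (fK : forall x, K x -> K (f x)) (L0 : 0 < L).
Hypothesis LF : forall k x y, K x -> K y -> `|iter k f x - iter k f y| <= L * `|x - y|.
Hypothesis LB : forall k x y, K x -> K y -> `|x - y| <= L * `|iter k f x - iter k f y|.
Implicit Types (p q : 'rV[R]_n).

Lemma iterK k x : K x -> K (iter k f x).
Proof. by move=> Kx; elim: k => //= k; exact: fK. Qed.

(* Pigeonhole: two points of an orbit in the compact set are close, and the
   iterates distort distances by a bounded factor. *)
Lemma recurrence p N (e : R) : K p -> 0 < e ->
  exists2 m, (N <= m)%N & `|iter m f p - p| < e.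
Proof.
(* Sampling the orbit every [N.+1] steps makes the return time [N.+1 * (j - i)] at least [N] as soon
   as [i < j]. *)
move=> Kp e0; pose g j := iter (N.+1 * j) f p.
have Kg : (g @ \oo) K by exists 0%N => // j _; exact: iterK.
have [a [Ka ca]] := cK (fmap_proper_filter g _) Kg.
have e1 : 0 < e / L / 2 by rewrite !divr_gt0.
have na : nbhs a (ball a (e / L / 2)) by exact: nbhsx_ballx.
have F0 : (g @ \oo) (range g) by exists 0%N => // j _; exists j.
have [_ [[i _ <-] bi]] := ca _ _ F0 na.
have F1 : (g @ \oo) [set g j | j in [set j | (i < j)%N]] by exists i.+1 => // j ij; exists j.
have [_ [[j /= ij <-] bj]] := ca _ _ F1 na.
exists (N.+1 * (j - i))%N; first by nia.
have gj : g j = iter (N.+1 * i) f (iter (N.+1 * (j - i)) f p).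
  by rewrite /g -iterD -mulnDr subnKC // ltnW.
have h := LB (N.+1 * i) (iterK (N.+1 * (j - i)) Kp) Kp.
apply: le_lt_trans h _; rewrite -gj -/(g i) mulrC -ltr_pdivlMr //.
move: bi bj; rewrite mx_norm_ball /ball_ /= => bi bj.
rewrite -(subrKA a) [ltRHS]splitr; apply: le_lt_trans (ler_normD _ _) _.
by rewrite ltrD // distrC.
Qed.

(** If [f^k p] is close to [q] and [f^m p] is back close to [p] with [m >= k], then [f^(m-k) q] is
    close to [f^m p], hence to [p]. The tolerance [e / (L + 1)] pays [L] times for the distortion
    and once for the return. *)
Lemma orbit_limit_sym p q : K p -> K q -> orbit_limit f p q -> orbit_limit f q p.
Proof.
move=> Kp Kq pq e e0; have e1 : 0 < e / (L + 1) by rewrite divr_gt0 // addr_gt0.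
have [k hk] := pq _ e1; have [m km hm] := recurrence k Kp e1.
exists (m - k)%N; rewrite -(subrKA (iter m f p)).
apply: le_lt_trans (ler_normD _ _) _.
have -> : iter m f p = iter (m - k) f (iter k f p) by rewrite -iterD subnK.
have h := LF (m - k) Kq (iterK k Kp); rewrite distrC in hk.
have -> : e = L * (e / (L + 1)) + e / (L + 1).
  by rewrite -{2}[e / (L + 1)]mul1r -mulrDl mulrC divfK // lt0r_neq0 // addr_gt0.
apply: ler_ltD.
  by apply: le_trans h _; rewrite ler_pM2l // ltW.
by rewrite -iterD subnK.
Qed.

Lemma orbit_limit_step p q : K p -> K q -> orbit_limit f p q -> orbit_limit f p (f q).
Proof.
move=> Kp Kq pq e e0; have [k hk] := pq (e / L) (divr_gt0 e0 L0).
exists k.+1; have := LF 1 (iterK k Kp) Kq => /= /le_lt_trans; apply.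
by rewrite mulrC -ltr_pdivlMr.
Qed.

Lemma orbit_limit_iter k p q : K p -> K q -> orbit_limit f p q -> orbit_limit f p (iter k f q).
Proof.
move=> Kp Kq pq; elim: k => //= k IH; apply: orbit_limit_step => //.
exact: iterK.
Qed.

Lemma orbit_limit_iterl k p q : K p -> K q -> orbit_limit f p q -> orbit_limit f (iter k f p) q.
Proof.
move=> Kp Kq pq; have Kfp := iterK k Kp.
by apply: orbit_limit_sym => //; apply: orbit_limit_iter => //; exact: orbit_limit_sym.
Qed.

Definition orbit_rel : set ('rV[R]_n * 'rV[R]_n) :=
  [set z | [/\ K z.1, K z.2 & orbit_limit f z.1 z.2]].

(** Closedness uses that [L] is the same for all iterates: the [k] that works for a nearby pair [w]
    also works for [z], with error [L * d + d + d]. *)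
Lemma compact_orbit_rel : compact orbit_rel.
Proof.
have sub : orbit_rel `<=` K `*` K by move=> z [].
apply: (subclosed_compact _ (compact_setX cK cK) sub).
have clK : closed K by exact: compact_closed.
move=> z cz.
have [Kz1 Kz2] : K z.1 /\ K z.2.
  have cKK : closed (K `*` K).
    apply: compact_closed; [exact: norm_hausdorff|exact: compact_setX].
  by have := closureS sub cz; rewrite -(closure_id _).1 // => -[].
split => // e e0.
pose d := e / (L + 2); have d0 : 0 < d by rewrite divr_gt0 // addr_gt0.
have [w [[Kw1 Kw2 ww] bw]] := cz _ (nbhsx_ballx z _ d0).
have [k hk] := ww d d0; exists k.
case: bw; rewrite mx_norm_ball /ball_ /= => b1 b2.
have h := LF k Kz1 Kw1.
have -> : iter k f z.1 - z.2 = (iter k f z.1 - iter k f w.1) + (iter k f w.1 - w.2) + (w.2 - z.2).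
  by rewrite !subrKA.
have -> : e = L * d + d + d.
  have {1}-> : e = d * (L + 2) by rewrite divfK // lt0r_neq0 // addr_gt0.
  ring.
apply: le_lt_trans (ler_normD _ _) _; apply: ltrD; last by rewrite distrC.
apply: le_lt_trans (ler_normD _ _) _; apply: ler_ltD => //.
by apply: le_trans h _; rewrite ler_pM2l // ltW.
Qed.

End Orbits.

Lemma within_continuousP (R : realType) (V : normedModType R) (A : set V) (F : V -> R) :
  {within A, continuous F} <->
  (forall z, A z -> forall e : R, 0 < e -> exists2 d : R, 0 < d &
     forall w, A w -> `|w - z| < d -> `|F w - F z| < e).
Proof.
split=> [/subspace_continuousP h z Az e e0|h].
  have /cvgrPdist_lt/(_ e e0) := h z Az.
  rewrite near_withinE => /nbhs_normP[d d0 hd]; exists d => // w Aw wz.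
  by rewrite distrC; apply: hd => //=; rewrite distrC.
apply/subspace_continuousP => z Az; apply/cvgrPdist_lt => e e0.
have [d d0 hd] := h z Az e e0; rewrite near_withinE.
apply/nbhs_normP; exists d => // w /= wz Aw.
by rewrite distrC; apply: hd => //; rewrite distrC.
Qed.

(** [F] is continuous only relative to [A], so closedness is taken in the subspace topology. *)
Lemma compact_superlevel (R : realType) (T : topologicalType) (A : set T) (F : T -> R) (m : R) :
  compact A -> {within A, continuous F} -> compact ([set z | m <= F z] `&` A).
Proof.
move=> cA cF; apply/compact_subspaceIP.
apply: (@subclosed_compact _ _ (A : set (subspace A))).
- apply: closedI; last exact: closed_subspaceT.
  have -> : [set z | m <= F z] = F @^-1` [set y | m <= y] by [].
  by apply: preimage_closed; [move=> z _; exact: cF|exact: closed_ge].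
- by have := (compact_subspaceIP A A).2; rewrite setIid; exact.
by move=> z [].
Qed.

(** * Extremal pairs of the orbit relation *)

Section MaximumPrinciple.
Variables (R : realType) (n : nat) (O K : set 'rV[R]_n) (f : 'rV[R]_n -> 'rV[R]_n)
  (L : R) (u : 'rV[R]_n -> R).
Hypotheses (cK : compact K) (fK : forall x, K x -> K (f x)) (L0 : 0 < L).
Hypothesis LF : forall k x y, K x -> K y -> `|iter k f x - iter k f y| <= L * `|x - y|.
Hypothesis LB : forall k x y, K x -> K y -> `|x - y| <= L * `|iter k f x - iter k f y|.
Hypotheses (oO : open O) (OK : O `<=` K) (uK : {within K, continuous u}).
Hypothesis ub : forall p, K p -> ~ O p -> u (f p) = u p.

Let T := orbit_rel K f.
Let phi (z : 'rV[R]_n * 'rV[R]_n) := u z.2 - u z.1.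

(** While the orbit stays outside [O], [ub] preserves [u] at each step, so at the first entrance
    into [O] the value is still [u p]. *)
Lemma escape p j :
  (exists2 i, O (iter i f p) & u (iter i f p) = u p) \/
  (forall i, (i <= j)%N -> ~ O (iter i f p) /\ u (iter i f p) = u p) \/ ~ K p.
Proof.
have [Kp|] := pselect (K p); last by right; right.
elim: j => [|j [h|[h|//]]]; [|by left|].
  have [Op|nOp] := pselect (O p); first by left; exists 0%N.
  by right; left => i; rewrite leqn0 => /eqP ->.
have [nO uj] := h j (leqnn j).
have uS : u (iter j.+1 f p) = u p by rewrite /= ub //; exact: iterK.
have [OS|nOS] := pselect (O (iter j.+1 f p)); first by left; exists j.+1.
right; left => i; rewrite leq_eqVlt => /orP[/eqP -> //|ij].
exact: h.
Qed.

Lemma escape_dichotomy p : K p ->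
  (exists2 i, O (iter i f p) & u (iter i f p) = u p) \/
  (forall i, ~ O (iter i f p) /\ u (iter i f p) = u p).
Proof.
move=> Kp; have [h|h] := pselect (exists2 i, O (iter i f p) & u (iter i f p) = u p).
  by left.
right=> i; have [//|[hi|//]] := escape p i.
exact: hi.
Qed.

Lemma within_fst (F : 'rV[R]_n -> R) : {within K, continuous F} ->
  {within T, continuous (fun z => F z.1)}.
Proof.
move=> /within_continuousP h; apply/within_continuousP => z [Kz _ _] e e0.
have [d d0 hd] := h _ Kz e e0; exists d => // w [Kw _ _] wz; apply: hd => //.
by apply: le_lt_trans wz; rewrite [leRHS]/Num.norm /= le_max lexx.
Qed.

Lemma within_snd (F : 'rV[R]_n -> R) : {within K, continuous F} ->
  {within T, continuous (fun z => F z.2)}.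
Proof.
move=> /within_continuousP h; apply/within_continuousP => z [_ Kz _] e e0.
have [d d0 hd] := h _ Kz e e0; exists d => // w [_ Kw _] wz; apply: hd => //.
by apply: le_lt_trans wz; rewrite [leRHS]/Num.norm /= le_max lexx orbT.
Qed.

Lemma within_phi : {within T, continuous phi}.
Proof.
by move=> z; apply: cvgB; [exact: (within_snd uK)|exact: (within_fst uK)].
Qed.

Lemma extremal_pair p : K p -> u (f p) != u p ->
  exists p0 q0, [/\ T (p0, q0), O p0, O q0, u p0 < u q0 &
    forall z, T z -> phi z <= u q0 - u p0 /\ (phi z = u q0 - u p0 -> u z.1 <= u p0)].
Proof.
move=> Kp up.
have Kfp := fK Kp.
have pf : orbit_limit f p (f p) by move=> e e0; exists 1%N; rewrite /= subrr normr0.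
have fp := orbit_limit_sym cK fK L0 LF LB Kp Kfp pf.
have cT : compact T by exact: compact_orbit_rel cK L0 LF.
have T0 : T !=set0 by exists (p, f p); split.
have [z1 Tz1 hz1] := compact_EVT_max T0 cT within_phi.
set M := phi z1 in hz1.
(* By symmetry both [(p, f p)] and [(f p, p)] are in [T], and one of them has positive [phi]. *)
have M0 : 0 < M.
  case: (ltgtP (u (f p)) (u p)) up => // h _.
    apply: (@lt_le_trans _ _ (phi (f p, p))); first by rewrite subr_gt0.
    by apply: hz1; rewrite inE; split.
  apply: (@lt_le_trans _ _ (phi (p, f p))); first by rewrite subr_gt0.
  by apply: hz1; rewrite inE; split.
(* Second extremal choice: [u z.1] is maximised over the compact set where [phi] attains [M]. *)
have cTM := @compact_superlevel R _ T phi M cT within_phi.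
have TM0 : ([set z | M <= phi z] `&` T) !=set0.
  by exists z1; split; [exact: lexx|rewrite inE in Tz1].
have cu1 : {within [set z | M <= phi z] `&` T, continuous (fun z => u z.1)}.
  by apply: continuous_subspaceW (within_fst uK) => z [].
have [[p1 q1] pq1 hmax] := compact_EVT_max TM0 cTM cu1.
rewrite inE in pq1; case: pq1 => /= Mpq [/= Kp1 Kq1 pq1].
have phiM : u q1 - u p1 = M.
  by apply/eqP; rewrite eq_le Mpq andbT; apply: (hz1 (p1, q1)); rewrite inE; split.
have cont_orbit p' q' : K p' -> K q' -> orbit_limit f p' q' ->
    (forall i, u (iter i f p') = u p') -> u q' = u p'.
  move=> Kp' Kq' pq' h; apply/eqP; rewrite -subr_eq0 -normr_le0; apply/ler_addgt0Pl => e e0.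
  have [d d0 hd] := (within_continuousP K u).1 uK _ Kq' _ e0.
  have [k hk] := pq' d d0; rewrite addr0 distrC -(h k); apply/ltW/hd => //.
  exact: iterK.
(* If the orbit of [p1] never met [O], [u] would be constant on it and, by continuity, on its
   closure, giving [u q1 = u p1] against [M > 0]. *)
have [[i Oi ui]|hp] := escape_dichotomy Kp1; last first.
  have := cont_orbit _ _ Kp1 Kq1 pq1 (fun i => (hp i).2) => E.
  by move: M0; rewrite -phiM E subrr ltxx.
have pq2 := orbit_limit_iterl cK fK L0 LF LB i Kp1 Kq1 pq1.
set p0 := iter i f p1 in Oi ui pq2; have Kp0 := OK Oi.
(* [p0] is in turn a limit of the orbit of [q1] and lies in the open set [O], so that orbit enters
   [O]. *)
have [[j Oj uj]|hq] := escape_dichotomy Kq1; last first.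
  have [d d0 hd] : exists2 d : R, 0 < d & forall y, `|y - p0| < d -> O y.
    by apply/near_distP; exact: open_nbhs_nbhs.
  have [k hk] := orbit_limit_sym cK fK L0 LF LB Kp0 Kq1 pq2 d0.
  by have [] := hq k; have := hd _ hk.
have pq3 := orbit_limit_iter fK L0 LF j Kp0 Kq1 pq2.
exists p0, (iter j f q1); rewrite uj ui phiM; split => //.
- by split => //=; exact: iterK.
- by rewrite -subr_gt0 phiM.
move=> z Tz; split; first by apply: hz1; rewrite inE.
by move=> E; apply: hmax; rewrite inE; split => //=; rewrite E.
Qed.

End MaximumPrinciple.

(** * Comparison near an extremal pair *)

Section Invariance.
Variables (R : realType) (n : nat) (O K : set 'rV[R]_n) (f : 'rV[R]_n -> 'rV[R]_n)
  (L : R) (u : 'rV[R]_n -> R).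
Hypotheses (cK : compact K) (fK : forall x, K x -> K (f x)) (L0 : 0 < L).
Hypothesis LF : forall k x y, K x -> K y -> `|iter k f x - iter k f y| <= L * `|x - y|.
Hypothesis LB : forall k x y, K x -> K y -> `|x - y| <= L * `|iter k f x - iter k f y|.
Hypotheses (oO : open O) (OK : O `<=` K) (uK : {within K, continuous u}).
Hypothesis ub : forall p, K p -> ~ O p -> u (f p) = u p.
Hypotheses (Kh : K `<=` hyp) (fh : forall x, hyp x -> hyp (f x)).
Hypothesis pull : forall v x, hyp x -> translator_jet v (f x) -> translator_jet (v \o f) x.
Hypotheses (u2 : Ck 2 O u).
Hypothesis u_sol : forall x, O x ->
  sqnorm (egrad u x) < lam x ^+ 2 /\ translator_op x (egrad u x) (ehess u x) = 0.

Let T := orbit_rel K f.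

Lemma pull_iter k v x : hyp x -> translator_jet v (iter k f x) ->
  translator_jet (v \o iter k f) x.
Proof.
move=> hx; elim: k v => [|k IH] v //= jv.
by apply: (IH (v \o f)); apply: pull => //; elim: (k) => //= j; exact: fh.
Qed.

Lemma translator_jet_sol x : O x -> translator_jet u x.
Proof.
move=> Ox; have [h1 h2] := u_sol Ox.
by exists (egrad u x), (ehess u x); split => //; exact: jet2_Ck oO Ox u2.
Qed.

Lemma within_barrier x0 al : {within K, continuous (barrier u x0 al)}.
Proof.
have ct : {within K, continuous (fun x => al * (u x - u x0))}.
  by move=> z; apply: cvgM; [exact: cvg_cst|apply: cvgB; [exact: uK|exact: cvg_cst]].
have cs : {within K, continuous (fun x => sqnorm (x - x0))}.
  apply: continuous_subspaceT => x; apply: differentiable_continuous.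
  by have [g [/nbhs_singleton[h _] _ _]] := jet2_sqdist x0 x.
move=> z; apply: cvgB; last exact: cs.
apply: cvgD; first exact: ct.
by apply: cvgM; [apply: cvgM; exact: ct|exact: cvg_cst].
Qed.

Lemma within_dist x0 : {within K, continuous (fun x => `|x - x0|)}.
Proof.
apply/within_continuousP => z Kz e e0; exists e => // y Ky yz.
apply: le_lt_trans (ler_dist_dist _ _) _.
by rewrite opprB addrA subrK.
Qed.

(** On the sphere either the barrier is below [- c], which gains [e * c], or the pair is not
    maximal, and compactness bounds its deficit below by some [d1]. Taking [e] small keeps half of
    [d1]. *)
Lemma strict_gap x0 (M al rho e0 : R) : O x0 -> 0 < rho -> 0 < e0 ->
  (forall z, T z -> u z.2 - u z.1 <= M /\ (u z.2 - u z.1 = M -> u z.1 <= u x0)) ->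
  (forall x, `|x - x0| <= rho -> u x <= u x0 -> barrier u x0 al x <= - sqnorm (x - x0)) ->
  exists e d : R, [/\ 0 < e, e <= e0, 0 < d &
    forall z, T z -> `|z.1 - x0| = rho ->
      u z.2 - u z.1 + e * barrier u x0 al z.1 <= M - d].
Proof.
move=> Ox0 rho0 e00 hM hb.
pose h (z : 'rV[R]_n * 'rV[R]_n) := barrier u x0 al z.1.
have ch : {within T, continuous h}.
  by apply: (@within_fst _ _ K f (barrier u x0 al)); exact: within_barrier.
have cT : compact T by exact: compact_orbit_rel cK L0 LF.
(* Half of [rho ^+ 2]: at maximal pairs on the sphere the barrier is at most [- rho ^+ 2], strictly
   below [- c]. *)
pose c := rho ^+ 2 / 2; have c0 : 0 < c by rewrite divr_gt0 // exprn_gt0.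
have cd1 : {within T, continuous (fun z : 'rV[R]_n * 'rV[R]_n => `|z.1 - x0|)}.
  by apply: (@within_fst _ _ K f (fun x => `|x - x0|)); exact: within_dist.
have cd2 : {within T, continuous (fun z : 'rV[R]_n * 'rV[R]_n => - `|z.1 - x0|)}.
  by move=> z; apply: cvgN; exact: cd1.
(* [A3] consists of the pairs on the sphere with barrier at least [- c], cut out by three superlevel
   conditions so that compactness is inherited each time. *)
pose A1 := [set z | - c <= h z] `&` T.
have sA1 : A1 `<=` T by move=> z [].
have cA1 : compact A1 by exact: compact_superlevel.
pose A2 := [set z | rho <= `|z.1 - x0|] `&` A1.
have sA2 : A2 `<=` T by move=> z [_ /sA1].
have cA2 : compact A2 by exact/compact_superlevel/(continuous_subspaceW sA1 cd1).
pose A3 := [set z | - rho <= - `|z.1 - x0|] `&` A2.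
have sA3 : A3 `<=` T by move=> z [_ /sA2].
have cA3 : compact A3 by exact/compact_superlevel/(continuous_subspaceW sA2 cd2).
have far z : T z -> `|z.1 - x0| = rho -> u z.2 - u z.1 = M -> h z < - c.
  move=> Tz zr /(hM z Tz).2 uz; apply: le_lt_trans (hb _ _ uz) _; first by rewrite zr.
  rewrite ltrN2; apply: lt_le_trans (norm_sqr_le_sqnorm _); rewrite zr /c.
  by have : 0 < rho ^+ 2 by [rewrite exprn_gt0]; lra.
have inA3 z : T z -> `|z.1 - x0| = rho -> - c <= h z -> A3 z.
  by move=> Tz zr hz; split; [|split; [|split]] => //=; rewrite ?zr.
have [[z3 A3z]|nA3] := pselect (A3 !=set0); last first.
  exists e0, (e0 * c); split => //; first by rewrite mulr_gt0.
  move=> z Tz zr; have hz : h z < - c.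
    by rewrite ltNge; apply/negP => hz; apply: nA3; exists z; exact: inA3.
  have := ler_wpM2l (ltW e00) (ltW hz); rewrite -/(h z); have := (hM z Tz).1; lra.
have cphi : {within A3, continuous (fun z : 'rV[R]_n * 'rV[R]_n => u z.2 - u z.1)}.
  exact: continuous_subspaceW sA3 (within_phi uK).
have [w Aw hw] := compact_EVT_max (ex_intro _ z3 A3z) cA3 cphi.
have [w' Aw' hw'] := compact_EVT_max (ex_intro _ z3 A3z) cA3 (continuous_subspaceW sA3 ch).
rewrite inE in Aw; have Tw := sA3 _ Aw.
pose d1 := M - (u w.2 - u w.1).
have d10 : 0 < d1.
  rewrite subr_gt0 lt_neqAle (hM w Tw).1 andbT; apply/eqP => E.
  case: Aw => /= w1 [/= w2 [w3 _]].
  have wr : `|w.1 - x0| = rho by apply/eqP; rewrite eq_le w2 andbT -lerN2.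
  by have := far w Tw wr E; rewrite ltNge w3.
pose B := `|h w'| + 1; have B0 : 0 < B by rewrite ltr_wpDl.
pose e := Num.min e0 (d1 / (2 * B)).
have e0' : 0 < e by rewrite lt_min e00 divr_gt0 // mulr_gt0.
have eB : e * B <= d1 / 2.
  apply: (@le_trans _ _ (d1 / (2 * B) * B)).
    by rewrite ler_pM2r // /e ge_min lexx orbT.
  by rewrite invfM mulrA divfK // lt0r_neq0.
exists e, (Num.min (d1 / 2) (e * c)); split => //.
- by rewrite /e ge_min lexx.
- by rewrite lt_min divr_gt0 // mulr_gt0.
move=> z Tz zr; rewrite -/(h z).
have [hz|hz] := leP (- c) (h z).
  have Az := inA3 z Tz zr hz.
  have h1 : u z.2 - u z.1 <= M - d1 by rewrite /d1 subKr; apply: hw; rewrite inE.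
  have h2 : h z <= B.
    by apply: le_trans (hw' z _) _; [rewrite inE|rewrite (le_trans (ler_norm _)) // lerDl].
  have h3 : e * h z <= e * B by rewrite ler_pM2l.
  have h4 : Num.min (d1 / 2) (e * c) <= d1 / 2 by rewrite ge_min lexx.
  lra.
have h1 := (hM z Tz).1.
have h2 : e * h z <= e * - c by rewrite ler_pM2l // ltW.
have h4 : Num.min (d1 / 2) (e * c) <= e * c by rewrite ge_min lexx orbT.
lra.
Qed.

Lemma invariant p : K p -> u (f p) = u p.
Proof.
move=> Kp; apply/eqP/negPn/negP => up.
have [p0 [q0 [[/= Kp0 Kq0 pq] Op Oq _ hM]]] :=
  extremal_pair cK fK L0 LF LB oO OK uK ub Kp up.
set M := u q0 - u p0 in hM.
have [al [rho [e0 [rho0 e00 hO hb nomax]]]] :=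
  barrier_no_max oO (fun x Ox => Kh (OK Ox)) u2 Op u_sol.
have [r r0 hr] : exists2 r : R, 0 < r & forall y, `|y - q0| < r -> O y.
  by apply/near_distP; exact: open_nbhs_nbhs.
(* With [L * rho1 <= r / 2], every iterate that moves [p0] to within [r / 2] of [q0] maps the
   [rho1]-ball around [p0], as far as it lies in [K], into [O]. *)
pose rho1 := Num.min rho (r / 2 / L).
have rho10 : 0 < rho1 by rewrite lt_min rho0 !divr_gt0.
have rr : rho1 <= rho by rewrite ge_min lexx.
have Lr : L * rho1 <= r / 2.
  by rewrite mulrC -ler_pdivlMr // ge_min lexx orbT.
have [e [d [e1 e2 d0 gap]]] := @strict_gap p0 M al rho1 e0 Op rho10 e00 hM
  (fun x xr => hb x (le_trans xr rr)).
have [d' d'0 hd'] := (within_continuousP K u).1 uK _ Kq0 _ d0.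
have m0 : 0 < Num.min d' (r / 2) by rewrite lt_min d'0 divr_gt0.
(* Only now is the iterate chosen: [d'] makes [u (iter k f p0)] differ from [u q0] by less than the
   gap [d], and [r / 2] serves to land in [O]. *)
have [k] := pq _ m0; rewrite lt_min => /andP[k1 k2].
pose w x := u (iter k f x) - u x + e * barrier u p0 al x.
pose B := [set x : 'rV[R]_n | - rho1 <= - `|x - p0|] `&` K.
have cB : compact B.
  apply: compact_superlevel => // z.
  by apply: cvgN; exact: within_dist.
have Bp : B p0 by split => //=; rewrite subrr normr0 oppr0 oppr_le0 ltW.
have cw : {within B, continuous w}.
  apply: (@continuous_subspaceW _ _ _ K); first by move=> z [].
  have cuk : {within K, continuous (fun x => u (iter k f x))}.
    apply/within_continuousP => z Kz c c0.
    have [d1 d10 hd1] := (within_continuousP K u).1 uK _ (iterK fK k Kz) _ c0.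
    exists (d1 / L); first by rewrite divr_gt0.
    move=> y Ky yz; apply: hd1; first exact: iterK.
    by apply: le_lt_trans (LF k Ky Kz) _; rewrite mulrC -ltr_pdivlMr.
  move=> z; apply: cvgD; first by apply: cvgB; [exact: cuk|exact: uK].
  by apply: cvgM; [exact: cvg_cst|exact: within_barrier].
have [x Bx hx] := compact_EVT_max (ex_intro _ p0 Bp) cB cw.
rewrite inE in Bx; case: Bx => /=; rewrite lerN2 => xr Kx.
have wp : M - d < w p0.
  rewrite /w /barrier !subrr mulr0 expr0n /= mul0r addr0 -dotvv dot0l subr0 mulr0 addr0.
  have := hd' _ (iterK fK k Kp0) k1; rewrite ltr_distl => /andP[h _].
  by rewrite /M; lra.
have wx : w p0 <= w x by apply: hx; rewrite inE.
(* On the sphere the gap applies to the pair [(x, iter k f x)], which is in the relation for every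
   [x] in [K], and gives [w x <= M - d < w p0]. *)
have xr' : `|x - p0| < rho1.
  rewrite lt_neqAle xr andbT; apply/eqP => E.
  have Tx : T (x, iter k f x).
    split => //=; first exact: iterK.
    by move=> c c0; exists k; rewrite subrr normr0.
  by have := gap _ Tx E; rewrite /= -/(w x) leNgt (lt_le_trans wp wx).
have Oxk : O (iter k f x).
  apply: hr; rewrite -(subrKA (iter k f p0)).
  apply: le_lt_trans (ler_normD _ _) _; rewrite [ltRHS]splitr; apply: ler_ltD => //.
  by apply: le_trans (LF k Kx Kp0) _; apply: le_trans Lr; rewrite ler_pM2l.
apply: (nomax x e (u \o iter k f)) => //; first exact: le_trans xr rr.
  by apply: pull_iter; [exact: Kh|exact: translator_jet_sol].
apply/near_distP; exists (rho1 - `|x - p0|); first by rewrite subr_gt0.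
move=> y yx; rewrite -/(w y) -/(w x); apply: hx; rewrite inE.
have yp : `|y - p0| <= rho1.
  by rewrite -(subrKA x); apply: le_trans (ler_normD _ _) _; lra.
by split; [rewrite /= lerN2|apply/OK/hO; exact: le_trans yp rr].
Qed.
End Invariance.

Theorem corollary5p1 (R : realType) (n : nat) (hn : (2 <= n)%N)
    (Omega : set 'rV[R]_n)
    (Omega_sub : Omega `<=` hyp)
    (Omega_open : open Omega)
    (Omega_connected : connected Omega)
    (Omega_bounded : riem_bounded ghyp hyp Omega)
    (sigma : 'rV[R]_n -> 'rV[R]_n)
    (sigma_isometry : riem_isometry ghyp hyp sigma)
    (sigma_Omega : sigma @` hclosure Omega = hclosure Omega)
    (u : 'rV[R]_n -> R)
    (u_C0 : {within hclosure Omega, continuous u})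
    (u_C2 : Ck 2 Omega u)
    (u_spacelike : spacelike Omega u)
    (u_translator : translator Omega u)
    (u_boundary : forall p, hboundary Omega p -> u (sigma p) = u p) :
  (forall p, hclosure Omega p -> u (sigma p) = u p) /\
  times_id sigma @` (graph_of u @` hclosure Omega)
  = graph_of u @` hclosure Omega.
Proof.
have inv p : hclosure Omega p -> u (sigma p) = u p.
  have [rho rho1 hrho] := riem_bounded_sqnorm Omega_sub Omega_bounded.
  have cK := compact_hclosure rho1 hrho.
  have Kr q : hclosure Omega q -> sqnorm q <= rho by case => /(closure_sqnorm hrho).
  have fK x : hclosure Omega x -> hclosure Omega (sigma x).
    by move=> Kx; rewrite -sigma_Omega; exists x.
  have Is := riem_isometry_loc sigma_isometry.
  have [s' [Is' s's]] := riem_isometry_inv sigma_isometry.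
  have inviter k x : hyp x -> iter k s' (iter k sigma x) = x.
    elim: k x => [//|k IH] x hx; have [hsx _] := loc_isom_iter k Is hx.
    by rewrite iterSr iterS (s's _ hsx).1 IH.
  have L0 : 0 < n.+1%:R / (1 - rho) by rewrite divr_gt0 // subr_gt0.
  have LF k x y (Kx : hclosure Omega x) (Ky : hclosure Omega y) :=
    loc_isom_lipschitz rho1 (loc_isom_iter k Is) (Kr x Kx) (Kr y Ky).
  have LB k x y : hclosure Omega x -> hclosure Omega y ->
      `|x - y| <= n.+1%:R / (1 - rho) * `|iter k sigma x - iter k sigma y|.
    (* The lower bound is the same Lipschitz estimate for the iterates of the inverse, at points of
       the closure. *)
    move=> Kx Ky; rewrite -{1}(inviter k x (proj2 Kx)) -{1}(inviter k y (proj2 Ky)).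
    apply: (loc_isom_lipschitz rho1 (loc_isom_iter k Is')); apply: Kr; exact: iterK.
  have [ss sh _ si] := sigma_isometry.
  apply: (invariant cK fK L0 LF LB Omega_open _ u_C0 _ _ sh) => //.
  - by move=> x Ox; split; [exact: subset_closure|exact: Omega_sub].
  - move=> q Kq nOq; apply: u_boundary; split => // iq.
    by apply: nOq; move: iq; exact: interior_subset.
  - by move=> x [].
  - move=> v x hx; exact: translator_jet_pullback.
  move=> x Ox; split; first exact: (spacelike_sqnorm Omega_sub u_spacelike Ox).
  exact: (translator_op0 Omega_open u_C2 Omega_sub u_spacelike Ox u_translator).
split=> //; apply/seteqP; split=> z.
  move=> [_ [p Kp <-] <-]; exists (sigma p).
    by rewrite -sigma_Omega; exists p.
  by rewrite /times_id /graph_of row_mxKl row_mxKr inv.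
(* The reverse inclusion uses that [sigma] maps the closure onto itself. *)
move=> [p Kp <-]; have [q Kq qp] : (sigma @` hclosure Omega) p by rewrite sigma_Omega.
exists (graph_of u q); first by exists q.
by rewrite /times_id /graph_of row_mxKl row_mxKr qp -qp inv.
Qed.
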